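(* With notation as in the context, let $g_0=(x_0,t_0)\in\widetilde{\mathbb M}\setminus\{o\}$ and let $\theta_0\in\Omega_*$ be a global maximizer of $\phi(g_0;\cdot)$ on $\Omega_*$. Then $d(g_0)^2=\phi(g_0;\theta_0)$, and there exists a unique shortest geodesic joining $o$ to $g_0$, namely $\gamma(s)=(x(s),t(s))$, $0\le s\le1$, with $$x(s)=\frac{\sin(sU(\theta_0))}{\sin U(\theta_0)}e^{(s-1)\widetilde U(\theta_0)}x_0,\quad t(s)=\frac12\int_0^s\langle\mathbb Ux(r),\zeta(r)\rangle dr,\quad \zeta(s)=\frac{U(\theta_0)}{\sin U(\theta_0)}e^{(2s-1)\widetilde U(\theta_0)}x_0.$$ Moreover, if $g_0\in\widetilde{\mathbb M}_2$, this shortest geodesic is abnormal.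
   Context: Let $q,m\ge1$, $U^{(1)},\dots,U^{(m)}$ linearly independent real skew-symmetric $q\times q$ matrices; $\mathbb G=\mathbb R^q\times\mathbb R^m$ with law $(x,t)\cdot(x',t')=(x+x',t+t'+\frac12\langle\mathbb Ux,x'\rangle)$, $\langle\mathbb Ux,x'\rangle=(\langle U^{(j)}x,x'\rangle)_j$, identity $o$. Horizontal curves: absolutely continuous $(x(s),t(s))$ with $t'=\frac12\langle\mathbb Ux,x'\rangle$, length $\int_0^1|x'|$; $d(g)$ is the infimum of lengths from $o$ to $g$; a shortest geodesic from $o$ to $g$ is a horizontal curve from $o$ to $g$ of length $d(g)$. $\widetilde U(\tau)=\sum_j\tau_jU^{(j)}$, $U(\tau)=i\widetilde U(\tau)$, $\Omega_*=\{\tau:\|U(\tau)\|<\pi\}$, $\phi((x,t);\tau)=\langle U(\tau)\cot U(\tau)x,x\rangle+4t\cdot\tau$. $\widetilde{\mathbb M}=\{g:\phi(g;\cdot)$ attains its maximum in $\Omega_*\}$, $\widetilde{\mathbb M}_2=\{g:$ the set of global maximizers of $\phi(g;\cdot)$ in $\Omega_*$ has at least two points$\}$. Normal geodesics: for $(\zeta_0,\theta)\in\mathbb R^q\times\mathbb R^m$, $\gamma(\zeta_0,2\theta;s)=(x(s),t(s))$ with $\zeta(s)=e^{2s\widetilde U(\theta)}\zeta_0$, $x(s)=\int_0^s\zeta$, $t(s)=\frac12\int_0^s\langle\mathbb Ux,\zeta\rangle$; its normal extremal lift is $s\mapsto(\gamma(s),(\zeta(s)-\widetilde U(\theta)x(s),\,2\theta))$.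 A normal geodesic is abnormal if it admits two distinct normal extremal lifts (i.e. it equals $\gamma(\zeta_0,2\theta;\cdot)$ and $\gamma(\zeta_0',2\theta';\cdot)$ with distinct lifts). Conventions: $\frac{\sin(s\cdot0)}{\sin0}=s$, $\frac0{\sin0}=1$.
   Formalization: Uniqueness of the shortest geodesic is understood up to reparametrization: every shortest geodesic from o to g_0 is γ(ρ(s)) with ρ nondecreasing, ρ(0)=0, ρ(1)=1, since the definition allows any parametrization and γ(s^2) is another curve of the same length. *)

(* Defs.v *)
From HB Require Import structures.
From mathcomp Require Import all_boot all_order all_algebra.
From mathcomp Require Import all_classical all_reals all_analysis.
Set Implicit Arguments. Unset Strict Implicit. Unset Printing Implicit Defensive.
Import Order.TTheory GRing.Theory Num.Theory.
Import numFieldNormedType.Exports.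
Local Open Scope classical_set_scope.
Local Open Scope ring_scope.

Section Defs.
Variable R : realType.

(* Vectors of R^n are row vectors 'rV[R]_n ; the column action A x of a
   matrix A on a vector x is written mxv A x := x *m A^T. *)
Definition mxv (n : nat) (A : 'M[R]_n) (x : 'rV[R]_n) : 'rV[R]_n := x *m A^T.

Definition dotv (n : nat) (u v : 'rV[R]_n) : R := \sum_(i < n) u 0 i * v 0 i.
Definition enorm (n : nat) (u : 'rV[R]_n) : R := Num.sqrt (dotv u u).

Definition Rint (a b : R) (f : R -> R) : R :=
  \int[@lebesgue_measure R]_(r in `[a, b]) f r.

Definition Rintv (n : nat) (a b : R) (f : R -> 'rV[R]_n) : 'rV[R]_n :=
  \row_(i < n) Rint a b (fun r => f r 0 i).

Definition expmx (n : nat) (A : 'M[R]_n) : 'M[R]_n :=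
  \matrix_(i, j) limn (series (fun k : nat => (A ^+ k) i j / (k`!)%:R)).

(* Spectral functional calculus for a real symmetric matrix W : h(W) is the
   (unique, by the spectral theorem) matrix acting as multiplication by h(l)
   on every l-eigenvector of W. *)
Definition mxfun (n : nat) (h : R -> R) (W : 'M[R]_n) : 'M[R]_n :=
  xget 0 [set M : 'M[R]_n | forall (l : R) (v : 'rV[R]_n),
            mxv W v = l *: v -> mxv M v = h l *: v].

Definition skew_family (q m : nat) (U : 'I_m -> 'M[R]_q) : Prop :=
  forall j, (U j)^T = - U j.
Definition lin_indep_family (q m : nat) (U : 'I_m -> 'M[R]_q) : Prop :=
  forall c : 'rV[R]_m, \sum_(j < m) c 0 j *: U j = 0 -> c = 0.

Definition Ut (q m : nat) (U : 'I_m -> 'M[R]_q) (tau : 'rV[R]_m) : 'M[R]_q :=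
  \sum_(j < m) tau 0 j *: U j.

(* U(tau)^2 = (i \tilde U(tau))^2 = - \tilde U(tau)^2 : a real symmetric
   positive semidefinite matrix.  All the (even) matrix functions of the
   Hermitian matrix U(tau) appearing in the statement are functions of it. *)
Definition Usq (q m : nat) (U : 'I_m -> 'M[R]_q) (tau : 'rV[R]_m) : 'M[R]_q :=
  - (Ut U tau *m Ut U tau).

Definition opnorm (q : nat) (A : 'M[R]_q) : R :=
  sup [set enorm (mxv A x) | x in [set x : 'rV[R]_q | enorm x <= 1]].

(* ||U(tau)|| = ||\tilde U(tau)|| *)
Definition Omega_star (q m : nat) (U : 'I_m -> 'M[R]_q) : set 'rV[R]_m :=
  [set tau | opnorm (Ut U tau) < pi].

(* scalar functions h with f(U) = h(U^2) for the even functions f *)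
Definition hcot (w : R) : R :=
  if w == 0 then 1 else Num.sqrt w * (cos (Num.sqrt w) / sin (Num.sqrt w)).
Definition hsinq (s : R) (w : R) : R :=
  if w == 0 then s else sin (s * Num.sqrt w) / sin (Num.sqrt w).
Definition hzsin (w : R) : R :=
  if w == 0 then 1 else Num.sqrt w / sin (Num.sqrt w).

Definition point (q m : nat) := ('rV[R]_q * 'rV[R]_m)%type.
Definition origin (q m : nat) : point q m := (0, 0).

Definition Uform (q m : nat) (U : 'I_m -> 'M[R]_q) (x x' : 'rV[R]_q)
  : 'rV[R]_m := \row_(j < m) dotv (mxv (U j) x) x'.

Definition phi (q m : nat) (U : 'I_m -> 'M[R]_q) (g : point q m)
  (tau : 'rV[R]_m) : R :=
  dotv (mxv (mxfun hcot (Usq U tau)) g.1) g.1 + 4 * dotv g.2 tau.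

Definition is_global_max (q m : nat) (U : 'I_m -> 'M[R]_q) (g : point q m)
  (tau : 'rV[R]_m) : Prop :=
  Omega_star U tau /\ forall tau', Omega_star U tau' -> phi U g tau' <= phi U g tau.

Definition Mtilde (q m : nat) (U : 'I_m -> 'M[R]_q) : set (point q m) :=
  [set g | exists tau, is_global_max U g tau].

Definition Mtilde2 (q m : nat) (U : 'I_m -> 'M[R]_q) : set (point q m) :=
  [set g | exists tau1 tau2, tau1 <> tau2 /\
             is_global_max U g tau1 /\ is_global_max U g tau2].

(* curves s |-> (x(s), t(s)), considered on [0,1] *)
Definition curve (q m : nat) := (R -> point q m)%type.

(* horizontal curve with velocity v: x absolutely continuous with x' = v
   (v integrable on [0,1]) and t' = 1/2 <U x, x'> *)
Definition horizontal (q m : nat) (U : 'I_m -> 'M[R]_q) (c : curve q m)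
  (v : R -> 'rV[R]_q) : Prop :=
  (forall i : 'I_q, (@lebesgue_measure R).-integrable `[0, 1]
                       (EFin \o (fun r => v r 0 i))) /\
  forall s, 0 <= s <= 1 ->
    (c s).1 = (c 0).1 + Rintv 0 s v /\
    (c s).2 = (c 0).2 + 2^-1 *: Rintv 0 s (fun r => Uform U (c r).1 (v r)).

Definition length (q : nat) (v : R -> 'rV[R]_q) : R :=
  Rint 0 1 (fun r => enorm (v r)).

Definition joins (q m : nat) (U : 'I_m -> 'M[R]_q) (c : curve q m)
  (v : R -> 'rV[R]_q) (g : point q m) : Prop :=
  horizontal U c v /\ c 0 = origin q m /\ c 1 = g.

Definition dist (q m : nat) (U : 'I_m -> 'M[R]_q) (g : point q m) : R :=
  inf [set L | exists c v, joins U c v g /\ L = length v].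

Definition shortest_geodesic (q m : nat) (U : 'I_m -> 'M[R]_q) (c : curve q m)
  (g : point q m) : Prop :=
  exists v, joins U c v g /\ length v = dist U g.

(* normal geodesic gamma(zeta0, 2 theta; .) and its normal extremal lift *)
Definition nzeta (q m : nat) (U : 'I_m -> 'M[R]_q) (zeta0 : 'rV[R]_q)
  (theta : 'rV[R]_m) (s : R) : 'rV[R]_q :=
  mxv (expmx ((2 * s) *: Ut U theta)) zeta0.
Definition ngeod (q m : nat) (U : 'I_m -> 'M[R]_q) (zeta0 : 'rV[R]_q)
  (theta : 'rV[R]_m) : curve q m :=
  fun s =>
    let x := fun r => Rintv 0 r (nzeta U zeta0 theta) in
    (x s, 2^-1 *: Rintv 0 s (fun r => Uform U (x r) (nzeta U zeta0 theta r))).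
Definition nlift (q m : nat) (U : 'I_m -> 'M[R]_q) (zeta0 : 'rV[R]_q)
  (theta : 'rV[R]_m) (s : R) : point q m * ('rV[R]_q * 'rV[R]_m) :=
  (ngeod U zeta0 theta s,
   (nzeta U zeta0 theta s - mxv (Ut U theta) (ngeod U zeta0 theta s).1,
    2 *: theta)).

(* a curve on [0,1] is an abnormal normal geodesic if it is a normal geodesic
   admitting two distinct normal extremal lifts *)
Definition abnormal (q m : nat) (U : 'I_m -> 'M[R]_q) (c : curve q m) : Prop :=
  exists zeta0 theta zeta0' theta',
    (forall s, 0 <= s <= 1 ->
       c s = ngeod U zeta0 theta s /\ c s = ngeod U zeta0' theta' s) /\
    exists s, 0 <= s <= 1 /\ nlift U zeta0 theta s <> nlift U zeta0' theta' s.

Definition gzeta (q m : nat) (U : 'I_m -> 'M[R]_q) (x0 : 'rV[R]_q)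
  (theta0 : 'rV[R]_m) (s : R) : 'rV[R]_q :=
  mxv (mxfun hzsin (Usq U theta0)) (mxv (expmx ((2 * s - 1) *: Ut U theta0)) x0).
Definition gx (q m : nat) (U : 'I_m -> 'M[R]_q) (x0 : 'rV[R]_q)
  (theta0 : 'rV[R]_m) (s : R) : 'rV[R]_q :=
  mxv (mxfun (hsinq s) (Usq U theta0)) (mxv (expmx ((s - 1) *: Ut U theta0)) x0).
Definition gamma0 (q m : nat) (U : 'I_m -> 'M[R]_q) (x0 : 'rV[R]_q)
  (theta0 : 'rV[R]_m) : curve q m :=
  fun s => (gx U x0 theta0 s,
            2^-1 *: Rintv 0 s (fun r => Uform U (gx U x0 theta0 r) (gzeta U x0 theta0 r))).

End Defs.

(* Main.v *)
(** Fix tau in Omega_*, B = Ut tau, W = - B^2, and C(s) = sqrt W cot (s sqrt W), which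
    solves C' = - (C^2 + W).  The function F(s, x, t) = <C(s) x, x> + 4 t.tau is a calibration:
    with p = (C(sigma) + B) x, its derivative along a horizontal curve with velocity v and clock
    sigma is 2 <p, v> - sigma' |p|^2.  For sigma' = |v| / L this is at most L |v|, which yields
    phi(g; tau) <= length^2 for every curve from o to g.

    The curve x of the theorem solves x'' = 2 B x', x(0) = 0, x(1) = x0, and x' = p along it.
    Comparing the trajectories of theta0 and theta0 + e u, the maximality of theta0 in the
    direction u = t0 - t(1) forces |u|^2 <= 0, so the curve ends at (x0, t0) and attains equality.

    In the equality case, with sigma the normalized arc length, v = sigma' p almost everywhere, so
    e = x - gx(sigma) satisfies e' = sigma' (C + B) e and |(sin (sigma sqrt W) / sqrt W)^-1 e| is
    constant, hence zero.  If tau is another maximizer, uniqueness identifies the two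
    constant-speed geodesics, whose lifts differ in the component 2 theta. *)

(* Competing curves have a merely integrable velocity, so every differential identity is stated for
   a pair (f, f') with f an indefinite integral of f', and then integrated.

   The main obstacle is that C(s) behaves like 1/s at s = 0, where every competitor starts. For the
   inequality the clock starts at a positive time, at the price of an L slightly above the length,
   and a limit follows; this is harmless because F vanishes at the identity o at every positive
   time. In the equality case the normalized arc length does start at 0, so the argument runs on
   [r0, 1] with a positive clock at r0, and draws its information from the common endpoint x0.

   The bound pi on the norm of U(tau) makes sin(s sqrt W) / sqrt W invertible for 0 < s <= 1. Since
   the bound is strict, it survives a dilation by some lambda > 1, and this margin gives the
   coercivity behind the first variation. *)
Require Import Defs.
From HB Require Import structures.
From mathcomp Require Import all_boot all_order all_algebra.
From mathcomp Require Import all_classical all_reals all_analysis.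
From mathcomp Require Import measurable_realfun ring lra.
From mathcomp Require complex.
(* required again because MathComp also has a constant [Rint] *)
Require Import Defs.
Set Implicit Arguments. Unset Strict Implicit. Unset Printing Implicit Defensive.
Import Order.TTheory GRing.Theory Num.Theory.
Import numFieldNormedType.Exports.
Local Open Scope classical_set_scope.
Local Open Scope ring_scope.

(** * Absolutely continuous functions *)

Section AbsolutelyContinuous.
Variable R : realType.
Local Notation mu := (@lebesgue_measure R).
Implicit Types (a b s : R) (f g h : R -> R).

Definition integrable_on a b f := mu.-integrable `[a, b] (EFin \o f).

Lemma integrable_on_sub a b a' b' f :
  a <= a' -> b' <= b -> integrable_on a b f -> integrable_on a' b' f.
Proof.
move=> aa' bb'; apply: integrableS => //.
by move=> x /=; rewrite !in_itv/= => /andP[? ?]; apply/andP; split; lra.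
Qed.

Lemma integrable_onD a b f g : integrable_on a b f -> integrable_on a b g ->
  integrable_on a b (fun r => f r + g r).
Proof.
by move=> fi gi; rewrite /integrable_on (_ : _ \o _ = (EFin \o f) \+ (EFin \o g))%E//; exact: integrableD.
Qed.

Lemma integrable_onZ a b (k : R) f : integrable_on a b f ->
  integrable_on a b (fun r => k * f r).
Proof.
by move=> fi; rewrite /integrable_on (_ : _ \o _ = (fun x => k%:E * (EFin \o f) x))%E//; exact: integrableZl.
Qed.

Lemma integrable_on_cst a b (k : R) : integrable_on a b (fun=> k).
Proof.
apply: continuous_compact_integrable; first exact: segment_compact.
by apply: continuous_subspaceT => x; exact: cst_continuous.
Qed.

Lemma integrable_onM a b f g : {within `[a, b], continuous f} ->
  integrable_on a b g -> integrable_on a b (fun r => f r * g r).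
Proof.
move=> cf gi.
rewrite /integrable_on (_ : _ \o _ = (EFin \o f) \* (EFin \o g))%E//.
apply: integrableMr => //.
  by apply: subspace_continuous_measurable_fun.
have /compact_bounded[M [_ mrt]] := continuous_compact cf (@segment_compact _ a b).
by exists M; split; rewrite ?num_real // => ? ? ? ?; exact: mrt.
Qed.

Lemma integrable_on_norm a b f : integrable_on a b f ->
  integrable_on a b (fun r => `|f r|).
Proof. by move=> fi; exact: (integrable_norm fi). Qed.

Lemma Rint_id a f : Rint a a f = 0.
Proof. by rewrite /Rint set_itv1 Rintegral_set1. Qed.

Lemma Rint_cat a b s f : a <= s -> s <= b -> integrable_on a b f ->
  Rint a b f = Rint a s f + Rint s b f.
Proof.
move=> as_ sb fi; have := Rintegral_itvB fi (x := s).
rewrite !bnd_simp => /(_ as_ sb).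
rewrite Rintegral_itv_obnd_cbnd; last first.
  apply: integrableS fi => //; apply: subset_itvr; by rewrite bnd_simp.
by rewrite /Rint => <-; rewrite addrC subrK.
Qed.

Lemma RintD a b f g : integrable_on a b f -> integrable_on a b g ->
  Rint a b (fun r => f r + g r) = Rint a b f + Rint a b g.
Proof. by move=> fi gi; apply: RintegralD. Qed.

Lemma RintZ a b (k : R) f : integrable_on a b f ->
  Rint a b (fun r => k * f r) = k * Rint a b f.
Proof. by move=> fi; apply: RintegralZl. Qed.

Lemma Rint_le a b f g : integrable_on a b f -> integrable_on a b g ->
  (forall r, a <= r <= b -> f r <= g r) -> Rint a b f <= Rint a b g.
Proof. by move=> fi gi fg; apply: le_Rintegral => // x /=; rewrite in_itv; exact: fg. Qed.

Lemma Rint_cst a b (k : R) : a <= b -> Rint a b (fun=> k) = (b - a) * k.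
Proof.
move=> ab; rewrite /Rint Rintegral_cst//= lebesgue_measure_itv/= lte_fin.
by move: ab; rewrite le_eqVlt => /predU1P[->|->]; rewrite ?ltxx ?subrr/=; ring.
Qed.

Lemma Rint_norm a b f : integrable_on a b f ->
  `|Rint a b f| <= Rint a b (fun r => `|f r|).
Proof. by move=> fi; apply: le_normr_Rintegral. Qed.

Lemma Rint_ext a b f g : (forall r, a <= r <= b -> f r = g r) ->
  Rint a b f = Rint a b g.
Proof.
by move=> fg; apply: eq_Rintegral => x; rewrite inE /= in_itv => /fg.
Qed.

(* Absolute continuity, encoded as being the indefinite integral of an integrable [f']. *)
Definition AC a b f f' := integrable_on a b f' /\
  forall s, a <= s <= b -> f s = f a + Rint a s f'.

Lemma AC_int a b (k : R) f' : integrable_on a b f' -> AC a b (fun s => k + Rint a s f') f'.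
Proof. by move=> fi; split=> // s _; rewrite Rint_id addr0. Qed.

Lemma AC_diff a b f f' s t : AC a b f f' -> a <= s -> s <= t -> t <= b ->
  f t - f s = Rint s t f'.
Proof.
move=> [fi fE] as_ st tb; rewrite (fE t) ?(fE s) ?(Rint_cat as_ st).
- ring.
- exact: integrable_on_sub fi.
- by apply/andP; split; lra.
- by apply/andP; split; lra.
Qed.

Lemma AC_sub a b a' b' f f' : a <= a' -> b' <= b -> AC a b f f' -> AC a' b' f f'.
Proof.
move=> aa' b'b fac; split; first by apply: integrable_on_sub fac.1.
move=> s /andP[a's sb'].
by rewrite -(AC_diff fac aa' a's) ?(le_trans sb')//; ring.
Qed.

Lemma AC_ext a b f g f' : (forall s, a <= s <= b -> f s = g s) ->
  AC a b f f' -> AC a b g f'.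
Proof.
move=> fg [fi fE]; split; first exact: fi.
move=> s sab; have /andP[as_ sb] := sab.
have aab : a <= a <= b by rewrite lexx (le_trans as_ sb).
by rewrite -(fg _ sab) -(fg _ aab); exact: fE.
Qed.

Lemma AC_ext' a b f f' g' : (forall s, a <= s <= b -> f' s = g' s) ->
  AC a b f f' -> AC a b f g'.
Proof.
move=> fg [fi fE]; split.
  apply/integrableP; split.
    apply: eq_measurable_fun (measurable_int _ fi) => x; rewrite inE /= in_itv/= => /fg ->//.
  have /integrableP[_] := fi; congr (_ < _)%E; apply: eq_integral => x.
  by rewrite inE /= in_itv/= => /fg ->.
move=> s /andP[as_ sb]; rewrite fE ?as_ ?sb//; congr (_ + _); apply: Rint_ext => r /andP[ar rs].
by apply: fg; apply/andP; split; lra.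
Qed.

Lemma AC_cst a b (k : R) : AC a b (fun=> k) (fun=> 0).
Proof.
split; first exact: integrable_on_cst.
by move=> s /andP[as_ _]; rewrite Rint_cst// mulr0 addr0.
Qed.

Lemma ACD a b f g f' g' : AC a b f f' -> AC a b g g' ->
  AC a b (fun s => f s + g s) (fun s => f' s + g' s).
Proof.
move=> [fi fE] [gi gE]; split; first exact: integrable_onD.
move=> s /andP[as_ sb]; rewrite RintD ?(fE s) ?(gE s) ?as_ ?sb//; first ring.
  exact: integrable_on_sub fi.
exact: integrable_on_sub gi.
Qed.

Lemma ACZ a b (k : R) f f' : AC a b f f' ->
  AC a b (fun s => k * f s) (fun s => k * f' s).
Proof.
move=> [fi fE]; split; first exact: integrable_onZ.
move=> s /andP[as_ sb]; rewrite RintZ ?(fE s) ?as_ ?sb//; first ring.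
exact: integrable_on_sub fi.
Qed.

Lemma ACN a b f f' : AC a b f f' -> AC a b (fun s => - f s) (fun s => - f' s).
Proof.
move=> /(ACZ (-1)) H; apply: AC_ext (AC_ext' _ H) => s _; ring.
Qed.

Lemma ACB a b f g f' g' : AC a b f f' -> AC a b g g' ->
  AC a b (fun s => f s - g s) (fun s => f' s - g' s).
Proof. by move=> fA gA; apply: ACD => //; exact: ACN. Qed.

Lemma AC_sum (I : finType) a b (f f' : I -> R -> R) :
  (forall i, AC a b (f i) (f' i)) ->
  AC a b (fun s => \sum_i f i s) (fun s => \sum_i f' i s).
Proof.
move=> fA; elim: (index_enum I) => [|i r IH].
  by have := AC_cst a b 0; congr AC; apply/funext => s; rewrite big_nil.
have := ACD (fA i) IH; congr AC; apply/funext => s; by rewrite big_cons.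
Qed.

Lemma AC_le a b f g f' g' : a <= b -> AC a b f f' -> AC a b g g' ->
  (forall s, a <= s <= b -> f' s <= g' s) -> f b - f a <= g b - g a.
Proof.
move=> ab fA gA fg; rewrite (AC_diff fA) ?(AC_diff gA)//.
by apply: Rint_le => //; [exact: fA.1|exact: gA.1].
Qed.

Lemma AC_continuous a b f f' : a <= b -> AC a b f f' -> {within `[a, b], continuous f}.
Proof.
move=> ab [fi fE].
have := parameterized_integral_continuous ab fi => ci.
have : {within `[a, b], continuous (fun s => f a + Rint a s f')}.
  by move=> x; apply: cvgD; [exact: cvg_cst|exact: ci].
apply: subspace_eq_continuous => x; rewrite inE /= in_itv/= => xab; apply/esym/fE; exact: xab.
Qed.

Lemma AC_continuousP a b f f' s (e : R) : a <= s <= b -> AC a b f f' -> 0 < e ->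
  exists2 d : R, (0 : R) < d & forall t, a <= t <= b -> `|t - s| < d -> `|f t - f s| < e.
Proof.
move=> /andP[as_ sb] fA e0.
have cf := AC_continuous (le_trans as_ sb) fA.
have sab : `[a, b]%classic s by rewrite /= in_itv/= as_ sb.
have /(_ s) := cf => /cvgrPdist_lt/(_ _ e0).
rewrite /prop_near1 /nbhs/= -nbhs_subspace_in//= => /nbhs_ballP[d /= d0 H].
exists d => // t tab td; rewrite distrC; apply: H => //=.
by rewrite /ball/= distrC.
Qed.

(** Continuous induction: the set of points [s] for which the bound holds between [a] and [s]
    contains its supremum, which cannot lie below [b]. The hypothesis compares [t] with the centre
    [s] only, so it is used once to the left of the supremum and once to its right. *)
Lemma local_to_global_increment (Phi V : R -> R) a b (e : R) : a <= b -> 0 <= e ->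
  (forall s t, a <= s -> s <= t -> t <= b -> V s <= V t) ->
  (forall s, a <= s <= b -> exists2 d, 0 < d &
     forall t, a <= t <= b -> `|t - s| < d -> `|Phi t - Phi s| <= e * `|V t - V s|) ->
  `|Phi b - Phi a| <= e * (V b - V a).
Proof.
move=> ab e0 Vm H.
pose S := [set s | a <= s <= b /\ `|Phi s - Phi a| <= e * (V s - V a)].
have Sa : S a by split; [rewrite lexx|rewrite !subrr normr0 mulr0].
have Sb : has_sup S by split; [exists a|exists b => s [/andP[]]].
have aS : a <= sup S by exact: ub_le_sup Sb.2 _ Sa.
have Sleb : sup S <= b by apply: ge_sup; [exists a|move=> s [/andP[]]].
have sab : a <= sup S <= b by rewrite aS.
have [d d0 Hd] := H _ sab.
have SS : S (sup S).
  split=> //; have [s Ss sd] := sup_adherent d0 Sb.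
  have sS : s <= sup S by exact: ub_le_sup Sb.2 _ Ss.
  have /(Hd _ Ss.1) : `|s - sup S| < d by rewrite distrC ger0_norm; lra.
  have := Ss.2; have := Vm _ _ (andP Ss.1).1 sS Sleb => V1.
  rewrite (distrC (V s)) (ger0_norm (x := V (sup S) - V s)) ?subr_ge0// => H1 H2.
  have := ler_normD (Phi s - Phi a) (Phi (sup S) - Phi s).
  rewrite (distrC (Phi (sup S)) (Phi s)).
  have -> : Phi s - Phi a + (Phi (sup S) - Phi s) = Phi (sup S) - Phi a by ring.
  nra.
have [Sb'|bS] := ltP (sup S) b; last first.
  have <- : sup S = b by apply/eqP; rewrite eq_le Sleb.
  exact: SS.2.
pose t := Num.min b (sup S + d / 2).
have St : sup S < t by rewrite lt_min Sb' ltrDl divr_gt0.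
have tb : t <= b by rewrite ge_min lexx.
have td : t <= sup S + d / 2 by rewrite ge_min lexx orbT.
have tab : a <= t <= b by apply/andP; split; lra.
have /(Hd _ tab) : `|t - sup S| < d by rewrite ger0_norm; lra.
have V1 := Vm _ _ aS (ltW St) tb.
rewrite (ger0_norm (x := V t - V (sup S))) ?subr_ge0// => H1.
have H2 := SS.2.
suff : t <= sup S by lra.
apply: ub_le_sup Sb.2 _ _; split => //.
have := ler_normD (Phi t - Phi (sup S)) (Phi (sup S) - Phi a).
have -> : Phi t - Phi (sup S) + (Phi (sup S) - Phi a) = Phi t - Phi a by ring.
nra.
Qed.

(** The mean value theorem turns the increment of [h] into [h' y] times the integral of [f']. This
    quantity and the integral of [h' (f r) * f' r] each differ from [h' y0] times the integral of
    [f'] by at most [e] times the variation, whence the factor 2. *)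
Lemma AC_comp_increment (P : R -> Prop) (h h' f f' : R -> R) a b (y0 d e : R) :
  a <= b -> AC a b f f' -> 0 <= e ->
  (forall y z w, P y -> P z -> y <= w <= z -> P w) ->
  (forall r, a <= r <= b -> P (f r) /\ `|f r - y0| < d) ->
  (forall y, P y -> is_derive y 1 h (h' y)) ->
  (forall y, P y -> `|y - y0| < d -> `|h' y - h' y0| <= e) ->
  integrable_on a b (fun r => h' (f r) * f' r) ->
  `|h (f b) - h (f a) - Rint a b (fun r => h' (f r) * f' r)|
     <= 2 * e * Rint a b (fun r => `|f' r|).
Proof.
move=> ab fA e0 Pc fP hD h'd hi.
have fi := fA.1.
have [y Py [yd hy]] : exists2 y, P y &
    `|y - y0| < d /\ h (f b) - h (f a) = h' y * (f b - f a).
  have [Pa da] : P (f a) /\ `|f a - y0| < d by apply: fP; rewrite lexx.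
  have [Pb db] : P (f b) /\ `|f b - y0| < d by apply: fP; rewrite lexx ab.
  have MV u v : P u -> P v -> u <= v -> exists2 y, u <= y <= v & h v - h u = h' y * (v - u).
    move=> Pu Pv uv; have [||y] := @MVT_segment _ h h' _ _ uv.
    - move=> x; rewrite in_itv/= => /andP[ux xv]; apply: hD.
      by apply: (Pc u v) => //; apply/andP; split; lra.
    - apply: derivable_within_continuous => x; rewrite in_itv/= => xuv.
      by have := hD _ (Pc _ _ _ Pu Pv xuv) => -[].
    - by rewrite in_itv/= => yuv E; exists y.
  have [fab|/ltW fba] := leP (f a) (f b).
  - have [y yab E] := MV _ _ Pa Pb fab; exists y; first exact: Pc yab.
    split=> //; move: da db yab; rewrite !ltr_norml => /andP[? ?] /andP[? ?] /andP[? ?].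
    by apply/andP; split; lra.
  - have [y yab E] := MV _ _ Pb Pa fba; exists y; first exact: Pc yab.
    split; last by lra.
    move: da db yab; rewrite !ltr_norml => /andP[? ?] /andP[? ?] /andP[? ?].
    by apply/andP; split; lra.
rewrite hy (AC_diff fA)//.
have di : integrable_on a b (fun r => - h' y0 * f' r + h' (f r) * f' r).
  by apply: integrable_onD => //; exact: integrable_onZ.
have -> : h' y * Rint a b f' - Rint a b (fun r => h' (f r) * f' r) =
   (h' y - h' y0) * Rint a b f' - Rint a b (fun r => - h' y0 * f' r + h' (f r) * f' r).
  rewrite RintD ?RintZ//; first ring.
  exact: integrable_onZ.
have I1 := Rint_norm fi; have I2 := Rint_norm di.
have I3 : Rint a b (fun r => `|- h' y0 * f' r + h' (f r) * f' r|) <=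
          e * Rint a b (fun r => `|f' r|).
  rewrite -RintZ; last exact: integrable_on_norm.
  apply: Rint_le.
  - exact: integrable_on_norm.
  - by apply/integrable_onZ/integrable_on_norm.
  - move=> r rab; have [Pr dr] := fP _ rab.
    rewrite (_ : _ + _ = (h' (f r) - h' y0) * f' r); last ring.
    by rewrite normrM ler_wpM2r// h'd.
have I4 : 0 <= Rint a b (fun r => `|f' r|) by apply: Rintegral_ge0.
have I5 := h'd _ Py yd.
apply: le_trans (ler_normB _ _) _; rewrite normrM.
have I6 : `|h' y - h' y0| * `|Rint a b f'| <= e * Rint a b (fun r => `|f' r|).
  by apply: ler_pM.
lra.
Qed.

(** Chain rule, obtained by comparing increments rather than by differentiating almost everywhere.
    The convex set [P] makes room for outer functions such as [ct] and the inverse of [sn], which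
    are singular at 0. *)
Lemma AC_comp (P : R -> Prop) (h h' f f' : R -> R) a b :
  a <= b -> AC a b f f' ->
  (forall y z w, P y -> P z -> y <= w <= z -> P w) ->
  (forall r, a <= r <= b -> P (f r)) ->
  (forall y, P y -> is_derive y 1 h (h' y)) ->
  (forall y, P y -> {for y, continuous h'}) ->
  AC a b (fun r => h (f r)) (fun r => h' (f r) * f' r).
Proof.
move=> ab fA Pc fP hD h'c.
have cf := AC_continuous ab fA.
have ch' : {within `[a, b], continuous (fun r => h' (f r))}.
  move=> x; have [xab|xab] := pselect (`[a, b]%classic x).
    by apply: continuous_comp; [exact: cf|apply: h'c; apply: fP; move: xab; rewrite /= in_itv].
  rewrite /continuous_at /nbhs/= -nbhs_subspace_out// => A /= Ax y ->.
  by have [e /= e0] := Ax; apply; rewrite /ball_/= subrr normr0.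
have hi : integrable_on a b (fun r => h' (f r) * f' r).
  by apply: integrable_onM => //; exact: fA.1.
split=> // s /andP[as_ sb].
(* the increments of Phi are locally at most 2 e times those of V, for every e, so Phi is constant *)
pose Phi r := h (f r) - Rint a r (fun r => h' (f r) * f' r).
pose V r := Rint a r (fun r => `|f' r|).
have Vi : integrable_on a b (fun r => `|f' r|) by apply: integrable_on_norm; exact: fA.1.
have Vd u v : a <= u -> u <= v -> v <= b -> V v - V u = Rint u v (fun r => `|f' r|).
  by move=> au uv vb; rewrite /V (Rint_cat au uv); [ring|exact: integrable_on_sub Vi].
have Vm u v : a <= u -> u <= v -> v <= b -> V u <= V v.
  by move=> au uv vb; rewrite -subr_ge0 Vd//; apply: Rintegral_ge0.
suff : forall e, 0 < e -> `|Phi s - Phi a| <= 2 * e * (V s - V a).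
  move=> H; have : Phi s - Phi a = 0.
    apply/eqP; rewrite -normr_le0; apply/ler_addgt0Pr => e e0; rewrite add0r.
    have V0 : 0 <= V s - V a by rewrite subr_ge0 Vm.
    (* The [+ 1] keeps the denominator positive when the variation is zero. *)
    have e1 : 0 < e / (2 * (V s - V a + 1)) by apply: divr_gt0 => //; lra.
    have := H _ e1.
    have -> : 2 * (e / (2 * (V s - V a + 1))) * (V s - V a) = e * ((V s - V a) / (V s - V a + 1)).
      by field; lra.
    move=> /le_trans; apply; rewrite -[leRHS]mulr1 ler_wpM2l ?ler_pdivrMr; lra.
  by rewrite /Phi Rint_id; lra.
move=> e e0.
apply: local_to_global_increment => //; first lra.
  by move=> u v au uv vs; apply: Vm => //; lra.
move=> u /andP[au us].
have uab : a <= u <= b by apply/andP; split; lra.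
have [d d0 Hd] : exists2 d, 0 < d & forall y, `|y - f u| < d -> `|h' y - h' (f u)| <= e.
  have /cvgrPdist_le/(_ _ e0) /nbhs_ballP[d /= d0 Hd] := h'c _ (fP _ uab).
  by exists d => // y yd; rewrite distrC; apply: Hd => /=; rewrite /ball/= distrC.
have [c c0 Hc] := AC_continuousP uab fA d0.
exists c => // t /andP[at_ ts] tc.
have key x y : a <= x -> x <= y -> y <= b -> (forall r, x <= r <= y -> `|r - u| < c) ->
    `|Phi y - Phi x| <= 2 * e * (V y - V x).
  move=> ax xy yb H; rewrite Vd//.
  have -> : Phi y - Phi x = h (f y) - h (f x) - Rint x y (fun r => h' (f r) * f' r).
    by rewrite /Phi (Rint_cat ax xy); [ring|exact: integrable_on_sub hi].
  apply: (@AC_comp_increment P h h' f f' x y (f u) d e) => //.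
  - exact: AC_sub fA.
  - exact: ltW.
  - move=> r /andP[xr ry]; split; first by apply: fP; apply/andP; split; lra.
    by apply: Hc; [apply/andP; split; lra|apply: H; apply/andP; split].
  - by move=> z _; exact: Hd.
  - exact: integrable_on_sub hi.
have [ut|/ltW tu] := leP u t.
  rewrite (ger0_norm (x := V t - V u)); last by rewrite subr_ge0 Vm//; lra.
  apply: key => //; first lra.
  move=> r /andP[ur rt]; move: tc; rewrite !ger0_norm; lra.
rewrite distrC (distrC (V t)) (ger0_norm (x := V u - V t)); last by rewrite subr_ge0 Vm//; lra.
apply: key => //; first lra.
move=> r /andP[ur rt]; move: tc; rewrite distrC (distrC r) !ger0_norm; lra.
Qed.

Lemma AC_id a b : AC a b id (fun=> 1).
Proof.
split; first exact: integrable_on_cst.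
by move=> s /andP[as_ _]; rewrite Rint_cst// mulr1 addrC subrK.
Qed.

Lemma AC_C1 (h h' : R -> R) a b : a <= b ->
  (forall y : R, is_derive y 1 h (h' y)) -> continuous h' -> AC a b h h'.
Proof.
move=> ab hD h'c.
have := @AC_comp (fun=> True) h h' _ _ a b ab (AC_id a b).
move=> /(_ (fun _ _ _ _ _ _ => I) (fun _ _ => I) (fun y _ => hD y) (fun y _ => h'c y)).
by apply: AC_ext' => s _; rewrite mulr1.
Qed.

(** Polarization, 4 f g = (f + g)^2 - (f - g)^2, reduces the product rule to the chain rule for
    squares. *)
Lemma ACM a b f g f' g' : a <= b -> AC a b f f' -> AC a b g g' ->
  AC a b (fun s => f s * g s) (fun s => f' s * g s + f s * g' s).
Proof.
move=> ab fA gA.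
have sq u u' : AC a b u u' -> AC a b (fun s => u s ^+ 2) (fun s => (2 * u s) * u' s).
  move=> uA; apply: (@AC_comp (fun=> True) (fun y => y ^+ 2) (fun y => 2 * y)) => //.
  - move=> y _; apply: DeriveDef; first exact: exprn_derivable.
    by rewrite exp_derive expr1 /GRing.scale /=; ring.
  - by move=> y _; apply: mulrl_continuous.
have := ACZ 4^-1 (ACB (sq _ _ (ACD fA gA)) (sq _ _ (ACB fA gA))).
move=> H; apply: AC_ext (AC_ext' _ H) => s _; by field.
Qed.

(** The only almost-everywhere argument: elsewhere two velocities are identified by showing that the
    norm of their difference has integral zero. *)
Lemma Rint_mul_null a b (k w : R -> R) : {within `[a, b], continuous k} ->
  integrable_on a b w -> Rint a b (fun r => `|w r|) = 0 ->
  Rint a b (fun r => k r * w r) = 0.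
Proof.
move=> ck wi w0.
have kwi := integrable_onM ck wi.
have mw := measurable_int _ wi.
have : (\int[mu]_(x in `[a, b]) `|(EFin \o w) x| = 0)%E.
  rewrite -[LHS]fineK; first by rewrite -[RHS]/(0%:E) -w0.
  apply: (@integrable_fin_num _ _ _ mu); [exact: measurable_itv|exact: (integrable_on_norm wi)].
move=> w0'; have w_ae := iffLR (@ae_eq_integral_abs _ _ _ mu _ (measurable_itv _) _ mw) w0'.
rewrite /Rint /Rintegral (@ae_eq_integral _ _ _ mu `[a, b]%classic (cst 0%E)) ?integral0//.
- exact: measurable_int kwi.
- by apply: filterS w_ae => x /= H xab; have [->] := H xab; rewrite mulr0.
Qed.

Lemma integrable_on_sum (I : finType) a b (f : I -> R -> R) :
  (forall i, integrable_on a b (f i)) ->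
  integrable_on a b (fun r => \sum_i f i r).
Proof.
move=> fi; elim: (index_enum I) => [|i r IH].
  by have := integrable_on_cst a b 0; congr integrable_on; apply/funext => s; rewrite big_nil.
have := integrable_onD (fi i) IH; congr integrable_on; apply/funext => s; by rewrite big_cons.
Qed.

Lemma Rint_sum (I : finType) a b (f : I -> R -> R) :
  (forall i, integrable_on a b (f i)) ->
  Rint a b (fun r => \sum_i f i r) = \sum_i Rint a b (f i).
Proof.
move=> fi.
have H : forall r : seq I, integrable_on a b (fun s => \sum_(i <- r) f i s) /\
    Rint a b (fun s => \sum_(i <- r) f i s) = \sum_(i <- r) Rint a b (f i).
  elim=> [|i r [IH1 IH2]].
    split; last by rewrite big_nil /Rint; under eq_Rintegral do rewrite big_nil; rewrite Rintegral_cst// mul0r.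
    by have := integrable_on_cst a b 0; congr integrable_on; apply/funext => s; rewrite big_nil.
  have E : (fun s => \sum_(j <- i :: r) f j s) = (fun s => f i s + \sum_(j <- r) f j s).
    by apply/funext => s; rewrite big_cons.
  by rewrite E big_cons RintD// IH2; split=> //; exact: integrable_onD.
exact: (H _).2.
Qed.

End AbsolutelyContinuous.

(** * Euclidean algebra of row vectors *)

Section VectorAlgebra.
Variable R : realType.
Implicit Types (n : nat).

Lemma mxvM n (A B : 'M[R]_n) x : mxv (A *m B) x = mxv A (mxv B x).
Proof. by rewrite /mxv trmx_mul mulmxA. Qed.

Lemma mxvDl n (A B : 'M[R]_n) x : mxv (A + B) x = mxv A x + mxv B x.
Proof. by rewrite /mxv raddfD mulmxDr. Qed.

Lemma mxvDr n (A : 'M[R]_n) x y : mxv A (x + y) = mxv A x + mxv A y.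
Proof. by rewrite /mxv mulmxDl. Qed.

Lemma mxvNl n (A : 'M[R]_n) x : mxv (- A) x = - mxv A x.
Proof. by rewrite /mxv raddfN mulmxN. Qed.

Lemma mxvNr n (A : 'M[R]_n) x : mxv A (- x) = - mxv A x.
Proof. by rewrite /mxv mulNmx. Qed.

Lemma mxvBr n (A : 'M[R]_n) x y : mxv A (x - y) = mxv A x - mxv A y.
Proof. by rewrite mxvDr mxvNr. Qed.

Lemma mxvBl n (A B : 'M[R]_n) x : mxv (A - B) x = mxv A x - mxv B x.
Proof. by rewrite mxvDl mxvNl. Qed.

Lemma mxvZl n k (A : 'M[R]_n) x : mxv (k *: A) x = k *: mxv A x.
Proof. by rewrite /mxv linearZ /= -scalemxAr. Qed.

Lemma mxvZr n k (A : 'M[R]_n) x : mxv A (k *: x) = k *: mxv A x.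
Proof. by rewrite /mxv -scalemxAl. Qed.

Lemma mxv0 n (A : 'M[R]_n) : mxv A 0 = 0.
Proof. by rewrite /mxv mul0mx. Qed.

Lemma mxv1 n (x : 'rV[R]_n) : mxv 1%:M x = x.
Proof. by rewrite /mxv trmx1 mulmx1. Qed.

Lemma mxv_suml n (I : finType) (A : I -> 'M[R]_n) x :
  mxv (\sum_i A i) x = \sum_i mxv (A i) x.
Proof. by rewrite /mxv raddf_sum mulmx_sumr. Qed.

Lemma mxvE n (A : 'M[R]_n) x i : mxv A x 0 i = \sum_j A i j * x 0 j.
Proof. by rewrite mxE; apply: eq_bigr => j _; rewrite mxE mulrC. Qed.

Lemma dotvE n (u v : 'rV[R]_n) : dotv u v = (u *m v^T) 0 0.
Proof. by rewrite mxE; apply: eq_bigr => i _; rewrite mxE. Qed.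

Lemma dotvC n (u v : 'rV[R]_n) : dotv u v = dotv v u.
Proof. by apply: eq_bigr => i _; rewrite mulrC. Qed.

Lemma dotvDl n (u v w : 'rV[R]_n) : dotv (u + v) w = dotv u w + dotv v w.
Proof. by rewrite !dotvE mulmxDl mxE. Qed.

Lemma dotvDr n (u v w : 'rV[R]_n) : dotv w (u + v) = dotv w u + dotv w v.
Proof. by rewrite !(dotvC w) dotvDl. Qed.

Lemma dotvZl n k (u v : 'rV[R]_n) : dotv (k *: u) v = k * dotv u v.
Proof. by rewrite !dotvE -scalemxAl mxE. Qed.

Lemma dotvZr n k (u v : 'rV[R]_n) : dotv u (k *: v) = k * dotv u v.
Proof. by rewrite !(dotvC u) dotvZl. Qed.

Lemma dotvNl n (u v : 'rV[R]_n) : dotv (- u) v = - dotv u v.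
Proof. by rewrite -scaleN1r dotvZl mulN1r. Qed.

Lemma dotvNr n (u v : 'rV[R]_n) : dotv u (- v) = - dotv u v.
Proof. by rewrite !(dotvC u) dotvNl. Qed.

Lemma dot0v n (u : 'rV[R]_n) : dotv 0 u = 0.
Proof. by rewrite -(scale0r 0) dotvZl mul0r. Qed.

Lemma dotv0 n (u : 'rV[R]_n) : dotv u 0 = 0.
Proof. by rewrite dotvC dot0v. Qed.

Lemma dotv_sumr n (I : finType) u (F : I -> 'rV[R]_n) :
  dotv u (\sum_i F i) = \sum_i dotv u (F i).
Proof. by elim/big_ind2: _ => [|x y x' y' <- <-|//]; rewrite ?dotv0 ?dotvDr. Qed.

Lemma dotv_mxv n (A : 'M[R]_n) u v : dotv (mxv A u) v = dotv u (mxv A^T v).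
Proof. by rewrite !dotvE /mxv trmx_mul trmxK -mulmxA. Qed.

Lemma dotv_ge0 n (u : 'rV[R]_n) : 0 <= dotv u u.
Proof. by apply: sumr_ge0 => i _; rewrite -expr2 sqr_ge0. Qed.

Lemma dotv_eq0 n (u : 'rV[R]_n) : dotv u u = 0 -> u = 0.
Proof.
move=> /eqP; rewrite psumr_eq0; last by move=> i _; rewrite -expr2 sqr_ge0.
move=> /allP H; apply/rowP => i; have := H i (mem_index_enum _).
by rewrite -expr2 sqrf_eq0 mxE => /eqP.
Qed.

Lemma enorm_ge0 n (u : 'rV[R]_n) : 0 <= enorm u.
Proof. exact: sqrtr_ge0. Qed.

Lemma enorm_sqr n (u : 'rV[R]_n) : enorm u ^+ 2 = dotv u u.
Proof. by rewrite sqr_sqrtr// dotv_ge0. Qed.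

Lemma enorm0 n : enorm (0 : 'rV[R]_n) = 0.
Proof. by rewrite /enorm dot0v sqrtr0. Qed.

Lemma enormZ n k (u : 'rV[R]_n) : enorm (k *: u) = `|k| * enorm u.
Proof. by rewrite /enorm dotvZl dotvZr mulrA -expr2 sqrtrM ?sqr_ge0// sqrtr_sqr. Qed.

Lemma cauchy_schwarz n (u v : 'rV[R]_n) : dotv u v <= enorm u * enorm v.
Proof.
have [->|u0] := eqVneq u 0; first by rewrite dot0v enorm0 mul0r.
have [->|v0] := eqVneq v 0; first by rewrite dotv0 enorm0 mulr0.
have pos (w : 'rV[R]_n) : w != 0 -> 0 < enorm w.
  move=> w0; rewrite lt_def enorm_ge0 andbT; apply: contra_neq w0 => E.
  by apply: dotv_eq0; rewrite -enorm_sqr E expr0n.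
(* expand | |v| u - |u| v |^2 >= 0 *)
have := dotv_ge0 (enorm v *: u - enorm u *: v).
rewrite !(dotvDl, dotvDr, dotvNl, dotvNr, dotvZl, dotvZr) (dotvC v u) -!enorm_sqr.
by move=> H; rewrite -(ler_pM2l (mulr_gt0 (pos _ u0) (pos _ v0))); lra.
Qed.

Lemma enormD n (u v : 'rV[R]_n) : enorm (u + v) <= enorm u + enorm v.
Proof.
rewrite -(@ler_pXn2r _ 2) ?nnegrE ?addr_ge0 ?enorm_ge0//.
rewrite enorm_sqr !(dotvDl, dotvDr) -!enorm_sqr (dotvC v u).
have := cauchy_schwarz u v; nra.
Qed.

Lemma abs_coord_le_enorm n (u : 'rV[R]_n) i : `|u 0 i| <= enorm u.
Proof.
rewrite -sqrtr_sqr ler_wsqrtr// /dotv (bigD1 i)//= -expr2 lerDl.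
by apply: sumr_ge0 => j _; rewrite -expr2 sqr_ge0.
Qed.

Lemma enorm_le_sum n (u : 'rV[R]_n) : enorm u <= \sum_i `|u 0 i|.
Proof.
rewrite [X in enorm X](row_sum_delta u).
have : forall r : seq 'I_n, enorm (\sum_(j <- r) u 0 j *: delta_mx 0 j) <= \sum_(j <- r) `|u 0 j|.
  elim=> [|j r IH]; first by rewrite !big_nil enorm0.
  rewrite !big_cons (le_trans (enormD _ _))// lerD// enormZ.
  suff -> : enorm (delta_mx 0 j : 'rV[R]_n) = 1 by rewrite mulr1.
  rewrite /enorm /dotv (bigD1 j)//= big1; last by move=> k kj; rewrite !mxE (negbTE kj) andbF mulr0.
  by rewrite !mxE !eqxx mulr1 addr0 sqrtr1.
exact.
Qed.

Lemma mxv_bounded n (A : 'M[R]_n) : exists2 K, 0 <= K & forall x, enorm (mxv A x) <= K * enorm x.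
Proof.
exists (\sum_i \sum_j `|A i j|).
  by do 2 apply: sumr_ge0 => ? _.
move=> x; apply: le_trans (enorm_le_sum _) _; rewrite mulr_suml; apply: ler_sum => i _.
rewrite mxvE (le_trans (ler_norm_sum _ _ _))// mulr_suml; apply: ler_sum => j _.
by rewrite normrM ler_wpM2l// abs_coord_le_enorm.
Qed.

Lemma skew_dotv n (B : 'M[R]_n) u v : B^T = - B -> dotv (mxv B u) v = - dotv u (mxv B v).
Proof. by move=> Bs; rewrite dotv_mxv Bs mxvNl dotvNr. Qed.

Lemma skew_dotv0 n (B : 'M[R]_n) u : B^T = - B -> dotv (mxv B u) u = 0.
Proof. by move=> Bs; have := skew_dotv u u Bs; rewrite (dotvC u); lra. Qed.

End VectorAlgebra.

(** * Vector-valued curves, absolutely continuous or differentiable *)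

Section VectorCurves.
Variable R : realType.
Implicit Types (a b : R) (n : nat).

Definition vAC n a b (x x' : R -> 'rV[R]_n) :=
  forall i, AC a b (fun s => x s 0 i) (fun s => x' s 0 i).

Lemma vAC_sub n a b a' b' (x x' : R -> 'rV[R]_n) : a <= a' -> b' <= b ->
  vAC a b x x' -> vAC a' b' x x'.
Proof. by move=> ? ? H i; apply: AC_sub (H i). Qed.

Lemma vAC_ext n a b (x y x' : R -> 'rV[R]_n) :
  (forall s, a <= s <= b -> x s = y s) -> vAC a b x x' -> vAC a b y x'.
Proof. by move=> xy H i; apply: AC_ext (H i) => s /xy ->. Qed.

Lemma vAC_ext' n a b (x x' y' : R -> 'rV[R]_n) :
  (forall s, a <= s <= b -> x' s = y' s) -> vAC a b x x' -> vAC a b x y'.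
Proof. by move=> xy H i; apply: AC_ext' (H i) => s /xy ->. Qed.

Lemma vACD n a b (x y x' y' : R -> 'rV[R]_n) : vAC a b x x' -> vAC a b y y' ->
  vAC a b (fun s => x s + y s) (fun s => x' s + y' s).
Proof.
by move=> xA yA i; have := ACD (xA i) (yA i); congr AC; apply/funext => s; rewrite mxE.
Qed.

Lemma vACN n a b (x x' : R -> 'rV[R]_n) : vAC a b x x' ->
  vAC a b (fun s => - x s) (fun s => - x' s).
Proof.
by move=> xA i; have := ACN (xA i); congr AC; apply/funext => s; rewrite mxE.
Qed.

Lemma vACB n a b (x y x' y' : R -> 'rV[R]_n) : vAC a b x x' -> vAC a b y y' ->
  vAC a b (fun s => x s - y s) (fun s => x' s - y' s).
Proof. by move=> xA yA; apply: vACD => //; exact: vACN. Qed.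

Lemma vACZ n a b (k k' : R -> R) (x x' : R -> 'rV[R]_n) : a <= b ->
  AC a b k k' -> vAC a b x x' ->
  vAC a b (fun s => k s *: x s) (fun s => k' s *: x s + k s *: x' s).
Proof.
by move=> ab kA xA i; have := ACM ab kA (xA i); congr AC; apply/funext => s; rewrite !mxE.
Qed.

Lemma vAC_mxv n a b (A : 'M[R]_n) (x x' : R -> 'rV[R]_n) : vAC a b x x' ->
  vAC a b (fun s => mxv A (x s)) (fun s => mxv A (x' s)).
Proof.
move=> xA i.
have := AC_sum (fun j => ACZ (A i j) (xA j)); congr AC; apply/funext => s; by rewrite mxvE.
Qed.

Lemma vAC_sum (I : finType) n a b (x x' : I -> R -> 'rV[R]_n) :
  (forall i, vAC a b (x i) (x' i)) ->
  vAC a b (fun s => \sum_i x i s) (fun s => \sum_i x' i s).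
Proof.
move=> xA i; have := AC_sum (fun j => xA j i); congr AC; apply/funext => s; by rewrite summxE.
Qed.

Lemma AC_dotv n a b (x y x' y' : R -> 'rV[R]_n) : a <= b ->
  vAC a b x x' -> vAC a b y y' ->
  AC a b (fun s => dotv (x s) (y s)) (fun s => dotv (x' s) (y s) + dotv (x s) (y' s)).
Proof.
move=> ab xA yA; have := AC_sum (fun j => ACM ab (xA j) (yA j)).
by apply: AC_ext' => s _; rewrite -big_split.
Qed.

Definition vder n (x x' : R -> 'rV[R]_n) :=
  forall i (s : R), is_derive s 1 (fun s => x s 0 i) (x' s 0 i).

Lemma vder_continuous n (x x' : R -> 'rV[R]_n) i : vder x x' -> continuous (fun s => x s 0 i).
Proof.
by move=> xD s; apply: differentiable_continuous; apply/derivable1_diffP; have [] := xD i s.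
Qed.

(** The second derivative [x''] is the source of the continuity of [x'] that [AC_C1] requires. *)
Lemma vAC_vder n a b (x x' x'' : R -> 'rV[R]_n) : a <= b ->
  vder x x' -> vder x' x'' -> vAC a b x x'.
Proof. by move=> ab xD x'D i; apply: AC_C1 => //; exact: vder_continuous x'D. Qed.

Lemma vAC_comp n a b (x x' x'' : R -> 'rV[R]_n) (f f' : R -> R) : a <= b ->
  vder x x' -> vder x' x'' -> AC a b f f' ->
  vAC a b (fun s => x (f s)) (fun s => f' s *: x' (f s)).
Proof.
move=> ab xD x'D fA i.
have := @AC_comp R (fun=> True) (fun s => x s 0 i) (fun s => x' s 0 i) f f' a b ab fA.
move=> /(_ (fun _ _ _ _ _ _ => I) (fun _ _ => I) (fun y _ => xD i y)).
have x'c (y : R) : True -> {for y, continuous (fun s => x' s 0 i)}.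
  by move=> _; exact: (@vder_continuous _ _ _ i x'D y).
by move=> /(_ x'c); apply: AC_ext' => s _; rewrite mxE mulrC.
Qed.

Lemma measurable_enorm n a b (x : R -> 'rV[R]_n) :
  (forall i, integrable_on a b (fun s => x s 0 i)) ->
  integrable_on a b (fun s => enorm (x s)).
Proof.
move=> xi.
have si : integrable_on a b (fun s => \sum_i `|x s 0 i|).
  by apply: integrable_on_sum => i; exact: integrable_on_norm.
apply: (le_integrable _ _ _ si) => //.
- apply/measurable_EFinP; apply: (@measurableT_comp _ _ _ _ _ _ (@Num.sqrt R)).
    by apply: continuous_measurable_fun; exact: sqrt_continuous.
  apply: measurable_sum => i; have /measurable_EFinP mi := measurable_int _ (xi i).
  exact: measurable_funM.
- move=> s _ /=; rewrite lee_fin ger0_norm ?enorm_ge0// ger0_norm ?enorm_le_sum//.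
  exact: sumr_ge0.
Qed.

End VectorCurves.

(** * Functional calculus of real symmetric matrices *)

Section RealSpectral.
Import complex.

(* Real matrices that are similar over the complex numbers are similar over the reals. *)
Lemma symmetric_diagonalizable (R : rcfType) (n : nat) (W : 'M[R]_n) :
  W^T = W ->
  exists (P : 'M[R]_n) (d : 'rV[R]_n),
    P \in unitmx /\ W = invmx P *m diag_mx d *m P.
Proof.
move=> Wsym.
pose C : numClosedFieldType := complex.complex R.
pose toC : {rmorphism R -> C} := complex.real_complex R.
have toC_real x : toC x \is Num.real by apply/complex.complex_realP; exists x.
pose Wc : 'M[C]_n := map_mx toC W.
have Wc_real : Wc \is a mxOver Num.real by apply/mxOverP => i j; rewrite mxE.
have Wc_sym : Wc \is symmetricmx.
  by apply/is_hermitianmxP; rewrite expr0 scale1r; apply/matrixP => i j; rewrite !mxE -{1}Wsym mxE.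
have Wc_herm := realsym_hermsym Wc_sym Wc_real.
have /hermitian_normalmx /orthomx_spectralP Wc_eq := Wc_herm.
have := hermitian_spectral_diag_real Wc_herm.
set D := spectral_diag _ in Wc_eq *; set Q := spectralmx _ in Wc_eq * => D_real.
pose d : 'rV[R]_n := map_mx (@complex.Re R) D.
have Dd : D = map_mx toC d.
  apply/rowP => i; rewrite !mxE; apply/esym/complex.RRe_real.
  by have /mxOverP := D_real.
have Qu : Q \in unitmx by exact: spectral_unit.
have sim : similar_in unitmx Wc (diag_mx D).
  exists Q => //; apply/similarP => //.
  by rewrite Wc_eq !mulmxA mulmxV // mul1mx.
have dD_real : diag_mx D \is a mxOver Num.real.
  apply/mxOverP => i j; rewrite mxE; apply: rpredMn; exact: (mxOverP D_real).
have [P] := real_similar sim Wc_real dD_real.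
rewrite inE => /andP[P_real P_unit] /(similarP P_unit) PW.
pose P' : 'M[R]_n := map_mx (@complex.Re R) P.
have PP' : P = map_mx toC P'.
  apply/matrixP => i j; rewrite !mxE; apply/esym/complex.RRe_real.
  by have /mxOverP := P_real.
have P'u : P' \in unitmx by rewrite -(map_unitmx toC) -PP'.
exists P', d; split => //.
apply: (@map_mx_inj _ _ toC); rewrite !map_mxM map_invmx -PP' map_diag_mx -Dd.
by rewrite -mulmxA -PW mulKmx.
Qed.

End RealSpectral.

(** Commuting with [diag_mx d] forces [A i j = 0] unless [d] takes the same value at [i] and [j],
    and there [h] also takes the same value. *)
Lemma comm_diag_map (R : fieldType) n (A : 'M[R]_n) (d : 'rV[R]_n) (h : R -> R) :
  diag_mx d *m A = A *m diag_mx d ->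
  diag_mx (map_mx h d) *m A = A *m diag_mx (map_mx h d).
Proof.
rewrite !mul_diag_mx !mul_mx_diag => /matrixP E.
apply/matrixP => i j; have {E} := E i j; rewrite !mxE => E.
have [->|dij] := eqVneq (d 0 i) (d 0 j); first by rewrite mulrC.
suff -> : A i j = 0 by rewrite mulr0 mul0r.
apply/eqP; have : (d 0 i - d 0 j) * A i j == 0 by rewrite mulrBl E; apply/eqP; ring.
by rewrite mulf_eq0 subr_eq0 (negbTE dij).
Qed.

Section FunctionalCalculus.
Variables (R : realType) (n : nat) (W : 'M[R]_n).
Hypothesis Wsym : W^T = W.
Implicit Types h k : R -> R.

Definition eigen (w : R) := exists2 v : 'rV[R]_n, v != 0 & mxv W v = w *: v.

(** Replaces the choice in [mxfun] by a formula. The matrix [P] need not be orthogonal; symmetry of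
    the result comes instead from the Gram matrix [P *m P^T], which commutes with the diagonal
    matrix because [W] is symmetric, hence also with its image under [h]. *)
Lemma mxfun_diag : exists (P : 'M[R]_n) (d : 'rV[R]_n), P \in unitmx /\
  (forall l, eigen (d 0 l)) /\ W = invmx P *m diag_mx d *m P /\
  forall h, mxfun h W = invmx P *m diag_mx (map_mx h d) *m P /\ (mxfun h W)^T = mxfun h W.
Proof.
have [P [d [Pu WE]]] := symmetric_diagonalizable Wsym.
have mxvW v : mxv W v = v *m W by rewrite /mxv Wsym.
have PW : P *m W = diag_mx d *m P by rewrite WE !mulmxA mulmxV// mul1mx.
have rowP_eig l : mxv W (row l P) = d 0 l *: row l P.
  by rewrite mxvW -row_mul PW; apply/rowP => j; rewrite !mxE (bigD1 l)//= big1 ?addr0 ?mxE ?eqxx//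
   => k kl; rewrite !mxE eq_sym (negbTE kl) mul0r.
exists P, d; split=> //; split.
  move=> l; exists (row l P) => //; apply: contraTneq Pu => P0.
  apply/negP => Pu.
  have := congr1 (fun v => v *m invmx P) P0.
  rewrite -row_mul mulmxV// mul0mx => /rowP/(_ l); rewrite !mxE eqxx => /eqP.
  by rewrite oner_eq0.
split=> // h.
set D := diag_mx (map_mx h d).
pose G := P *m P^T.
have GT : G^T = G by rewrite /G trmx_mul trmxK.
have GD : diag_mx d *m G = G *m diag_mx d.
  have : (P *m W *m P^T)^T = P *m W *m P^T by rewrite !trmx_mul trmxK Wsym mulmxA.
  by rewrite PW -mulmxA -/G trmx_mul GT tr_diag_mx => ->.
have GDh : D *m G = G *m D by exact: comm_diag_map.
pose M := invmx P *m D *m P.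
have MT : M^T = M.
  have PTu : P^T \in unitmx by rewrite unitmx_tr.
  rewrite /M !trmx_mul tr_diag_mx trmx_inv -/D.
  apply: (can_inj (mulKmx Pu)); apply: (can_inj (mulmxK PTu)).
  by rewrite !mulmxA mulmxV// mul1mx -[RHS]mulmxA -/G GDh -!mulmxA mulVmx// mulmx1 -/G /G !mulmxA.
suff -> : mxfun h W = M by [].
have Mok l v : mxv W v = l *: v -> mxv M v = h l *: v.
  rewrite mxvW /mxv MT /M => vW.
  have vW' : v *m invmx P *m diag_mx d = l *: (v *m invmx P).
    by rewrite scalemxAl -vW WE -!mulmxA mulmxV// mulmx1.
  have vD : v *m invmx P *m D = h l *: (v *m invmx P).
    move: vW'; rewrite /D; move: (v *m invmx P) => u; rewrite !mul_mx_diag => /rowP E.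
    apply/rowP => j; have {E} := E j; rewrite !mxE => E.
    have [dl|dl] := eqVneq (d 0 j) l; first by rewrite dl mulrC.
    suff -> : u 0 j = 0 by rewrite mulr0 mul0r.
    apply/eqP; have : (d 0 j - l) * u 0 j == 0 by rewrite mulrBl -E mulrC subrr.
    by rewrite mulf_eq0 subr_eq0 (negbTE dl).
  by rewrite !mulmxA vD -!scalemxAl -mulmxA mulVmx// mulmx1.
rewrite /mxfun; apply: xget_unique => // M' M'ok.
(* The rows of [P] are a basis of eigenvectors of [W], so the defining property determines [M']. *)
suff : P *m M'^T = D *m P.
  by move=> E; rewrite -[M']trmxK -[M'^T](mulKmx Pu) E mulmxA -/M MT.
apply/row_matrixP => l; rewrite !row_mul -/(mxv M' _) (M'ok _ _ (rowP_eig l)).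
apply/rowP => j; rewrite !mxE (bigD1 l)//= big1 ?addr0 ?mxE ?eqxx//.
by move=> k kl; rewrite !mxE eq_sym (negbTE kl) mul0r.
Qed.

Lemma mxfun_trmx h : (mxfun h W)^T = mxfun h W.
Proof. by have [P [d [_ [_ [_ /(_ h)[]]]]]] := mxfun_diag. Qed.

Lemma eq_mxfun h k : (forall w, eigen w -> h w = k w) -> mxfun h W = mxfun k W.
Proof.
have [P [d [_ [de [_ H]]]]] := mxfun_diag => hk; rewrite (H h).1 (H k).1.
by congr (_ *m diag_mx _ *m _); apply/rowP => i; rewrite !mxE hk.
Qed.

Lemma mxfunM h k : mxfun h W *m mxfun k W = mxfun (fun w => h w * k w) W.
Proof.
have [P [d [Pu [de [_ H]]]]] := mxfun_diag; rewrite !(H _).1 !mulmxA mulmxK//.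
congr (_ *m _); rewrite -!mulmxA; congr (_ *m _).
by apply/matrixP => i j; rewrite mul_diag_mx !mxE -mulrnAr.
Qed.

Lemma mxfunD h k : mxfun h W + mxfun k W = mxfun (fun w => h w + k w) W.
Proof.
have [P [d [Pu [de [_ H]]]]] := mxfun_diag; rewrite !(H _).1 -mulmxDl -mulmxDr.
by congr (_ *m _ *m _); apply/matrixP => i j; rewrite !mxE mulrnDl.
Qed.

Lemma mxfunN h : - mxfun h W = mxfun (fun w => - h w) W.
Proof.
have [P [d [Pu [de [_ H]]]]] := mxfun_diag; rewrite !(H _).1 -mulNmx -mulmxN.
by congr (_ *m _ *m _); apply/matrixP => i j; rewrite !mxE mulNrn.
Qed.

Lemma mxfunZ c h : c *: mxfun h W = mxfun (fun w => c * h w) W.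
Proof.
have [P [d [Pu [de [_ H]]]]] := mxfun_diag; rewrite !(H _).1 scalemxAl scalemxAr.
by congr (_ *m _ *m _); apply/matrixP => i j; rewrite !mxE mulrnAr.
Qed.

Lemma mxfun_id : mxfun id W = W.
Proof.
have [P [d [Pu [de [WE H]]]]] := mxfun_diag; rewrite (H id).1 [RHS]WE.
by congr (_ *m diag_mx _ *m _); apply/rowP => i; rewrite !mxE.
Qed.

Lemma mxfun1 : mxfun (fun=> 1) W = 1%:M.
Proof.
have [P [d [Pu [de [WE H]]]]] := mxfun_diag; rewrite (H _).1.
have -> : diag_mx (map_mx (fun=> 1 : R) d) = 1%:M by apply/matrixP => i j; rewrite !mxE.
by rewrite mulmx1 mulVmx.
Qed.

Lemma mxfun_comm (B : 'M[R]_n) h : B *m W = W *m B -> B *m mxfun h W = mxfun h W *m B.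
Proof.
have [P [d [Pu [de [WE H]]]]] := mxfun_diag; rewrite (H h).1 {1 2}WE => BW.
set D := diag_mx (map_mx h d); pose C := P *m B *m invmx P.
have CD : C *m diag_mx d = diag_mx d *m C.
  apply: (can_inj (mulmxK Pu)); apply: (can_inj (mulKVmx Pu)).
  by move: BW; rewrite /C !mulmxA mulVmx// mul1mx -!mulmxA mulVmx// mulmx1 !mulmxA.
have CDh : C *m D = D *m C by apply/esym/comm_diag_map/esym.
have -> : B = invmx P *m C *m P by rewrite /C !mulmxA mulVmx// mul1mx -mulmxA mulVmx// mulmx1.
by move: C D CDh {CD} => C D CDh; rewrite !mulmxA !mulmxK// -(mulmxA _ C D) CDh mulmxA.
Qed.

(** The matrices [E l] do not depend on [h], so regularity of [mxfun (k s) W] in the parameter [s]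
    reduces to that of the scalars [k s w]. *)
Lemma mxfun_sum : exists (E : 'I_n -> 'M[R]_n) (d : 'I_n -> R),
  (forall l, eigen (d l)) /\ forall h, mxfun h W = \sum_l h (d l) *: E l.
Proof.
have [P [d [Pu [de [WE H]]]]] := mxfun_diag.
exists (fun l => invmx P *m delta_mx l l *m P), (d 0); split=> // h.
rewrite (H h).1.
have -> : diag_mx (map_mx h d) = \sum_l h (d 0 l) *: delta_mx l l.
  apply/matrixP => i j; rewrite summxE !mxE (bigD1 i)//= big1 ?addr0.
    by rewrite !mxE eqxx /= (eq_sym j) mulr_natr.
  by move=> k ki; rewrite !mxE eq_sym (negbTE ki) mulr0.
rewrite mulmx_sumr mulmx_suml; apply: eq_bigr => l _.
by rewrite -scalemxAr -scalemxAl.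
Qed.

Lemma mxfun0 : mxfun (fun=> 0) W = 0.
Proof. by have [E [d [_ ->]]] := mxfun_sum; apply: big1 => l _; rewrite scale0r. Qed.

Lemma vAC_mxfun a b (k k' : R -> R -> R) (y y' : R -> 'rV[R]_n) : a <= b ->
  (forall w, eigen w -> AC a b (k^~ w) (k'^~ w)) -> vAC a b y y' ->
  vAC a b (fun r => mxv (mxfun (k r) W) (y r))
          (fun r => mxv (mxfun (k' r) W) (y r) + mxv (mxfun (k r) W) (y' r)).
Proof.
move=> ab kA yA; have [E [d [de H]]] := mxfun_sum.
have := vAC_sum (fun l => vACZ ab (kA _ (de l)) (vAC_mxv (E l) yA)).
move=> HA; apply: (vAC_ext _ (vAC_ext' _ HA)) => s _.
  by rewrite H mxv_suml; apply: eq_bigr => l _; rewrite mxvZl.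
rewrite !H !mxv_suml -big_split; apply: eq_bigr => l _ /=.
by rewrite !mxvZl.
Qed.

Lemma vder_mxfun (k k' : R -> R -> R) (u : 'rV[R]_n) :
  (forall w, eigen w -> forall s : R, is_derive s 1 (k^~ w) (k' s w)) ->
  vder (fun r => mxv (mxfun (k r) W) u) (fun r => mxv (mxfun (k' r) W) u).
Proof.
move=> kD i s; have [E [d [de H]]] := mxfun_sum.
have -> : (fun r => mxv (mxfun (k r) W) u 0 i) =
    \sum_l (fun r => (mxv (E l) u 0 i) *: k r (d l)).
  apply/funext => r; rewrite fct_sumE H mxv_suml summxE.
  by apply: eq_bigr => l _; rewrite mxvZl mxE mulrC.
have -> : mxv (mxfun (k' s) W) u 0 i = \sum_l (mxv (E l) u 0 i) *: k' s (d l).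
  by rewrite H mxv_suml summxE; apply: eq_bigr => l _; rewrite mxvZl mxE mulrC.
apply: is_derive_sum => l; apply: is_deriveZ; exact: kD.
Qed.

End FunctionalCalculus.

(** * Trigonometric functions of s sqrt w, including w = 0 *)

Section TrigScalars.
Variable R : realType.
Implicit Types (s w : R).

(* [cs s w] and [sn s w] solve y'' = - w y with data (1, 0) and (0, 1) at s = 0 *)
Definition cs s w : R := cos (s * Num.sqrt w).
Definition sn s w : R := if w == 0 then s else sin (s * Num.sqrt w) / Num.sqrt w.

Lemma sqrtr_neq0 w : 0 <= w -> w != 0 -> Num.sqrt w != 0.
Proof. by move=> w0 wn0; rewrite sqrtr_eq0 -ltNge lt_def wn0. Qed.

Lemma sn0 w : sn 0 w = 0.
Proof. by rewrite /sn; case: ifP => // _; rewrite mul0r sin0 mul0r. Qed.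

Lemma cs0 w : cs 0 w = 1.
Proof. by rewrite /cs mul0r cos0. Qed.

Lemma snD s t w : 0 <= w -> sn (s + t) w = sn s w * cs t w + cs s w * sn t w.
Proof.
move=> w0; rewrite /sn /cs; case: ifPn => [/eqP ->|wn0].
  by rewrite sqrtr0 !mulr0 cos0 mulr1 mul1r.
have := sqrtr_neq0 w0 wn0; rewrite mulrDl sinD => ?; by field.
Qed.

Lemma csD s t w : 0 <= w -> cs (s + t) w = cs s w * cs t w - w * sn s w * sn t w.
Proof.
move=> w0; rewrite /sn /cs; case: ifPn => [/eqP ->|wn0].
  by rewrite sqrtr0 !mulr0 cos0 !mul0r mulr1 subr0.
rewrite mulrDl cosD; move: (sqr_sqrtr w0) (sqrtr_neq0 w0 wn0).
move: (Num.sqrt w) => r E r0; rewrite -E; by field.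
Qed.

Lemma is_derive_scale (r s : R) : is_derive s 1 (fun t => t * r) r.
Proof.
have -> : (fun t => t * r) = r *: id by apply/funext => t; rewrite /GRing.scale /= mulrC.
by apply: is_derive_eq; rewrite /GRing.scale /= mulr1.
Qed.

Lemma is_derive_sin_scale (r s : R) :
  is_derive s 1 (fun t => sin (t * r)) (cos (s * r) * r).
Proof. exact: is_derive1_comp (is_derive_sin _) (is_derive_scale r s). Qed.

Lemma is_derive_cos_scale (r s : R) :
  is_derive s 1 (fun t => cos (t * r)) (- sin (s * r) * r).
Proof. exact: is_derive1_comp (is_derive_cos _) (is_derive_scale r s). Qed.

Lemma is_derive_sn s w : 0 <= w -> is_derive s 1 (sn^~ w) (cs s w).
Proof.
move=> w0; rewrite /cs; have [->|wn0] := eqVneq w 0.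
  rewrite sqrtr0 mulr0 cos0.
  have -> : sn^~ 0 = id by apply/funext => t; rewrite /sn eqxx.
  exact: is_derive_id.
have -> : sn^~ w = (Num.sqrt w)^-1 *: (fun t => sin (t * Num.sqrt w)).
  by apply/funext => t; rewrite /sn (negbTE wn0) mulrC.
apply: is_derive_eq (is_deriveZ _ (is_derive_sin_scale _ _)) _.
by rewrite /GRing.scale /=; have := sqrtr_neq0 w0 wn0 => ?; field.
Qed.

Lemma is_derive_cs s w : 0 <= w -> is_derive s 1 (cs^~ w) (- w * sn s w).
Proof.
move=> w0; apply: is_derive_eq (is_derive_cos_scale _ _) _.
rewrite /sn; case: ifPn => [/eqP ->|wn0]; first by rewrite sqrtr0 oppr0 mul0r mulr0.
have := sqrtr_neq0 w0 wn0 => ?; rewrite -[X in - X * (_ / _)](sqr_sqrtr w0); by field.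
Qed.

Lemma is_derive_affine (k c s : R) : is_derive s 1 (fun t => k * t - c) k.
Proof.
have -> : (fun t => k * t - c) = k *: id - cst c by [].
apply: is_derive_eq (is_deriveB (is_deriveZ k (is_derive_id s 1)) (is_derive_cst c s 1)) _.
by rewrite /GRing.scale /= mulr1 subr0.
Qed.

Lemma is_derive_sn_affine k c s w : 0 <= w ->
  is_derive s 1 (fun t => sn (k * t - c) w) (cs (k * s - c) w * k).
Proof. by move=> w0; exact: is_derive1_comp (is_derive_sn _ w0) (is_derive_affine k c s). Qed.

Lemma is_derive_cs_affine k c s w : 0 <= w ->
  is_derive s 1 (fun t => cs (k * t - c) w) (- w * sn (k * s - c) w * k).
Proof. by move=> w0; exact: is_derive1_comp (is_derive_cs _ w0) (is_derive_affine k c s). Qed.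

(** The bound on the norm of U(tau) acts through this positivity: s sqrt w stays in (0, pi), where
    the sine does not vanish. *)
Lemma sn_gt0 s w : 0 <= w -> w < pi ^+ 2 -> 0 < s -> s <= 1 -> 0 < sn s w.
Proof.
move=> w0 wpi s0 s1; rewrite /sn; case: ifPn => // wn0.
have sw : 0 < Num.sqrt w by rewrite lt_def sqrtr_neq0// sqrtr_ge0.
have swpi : Num.sqrt w < pi.
  have E := sqr_sqrtr w0; have p0 := pi_gt0 R.
  by rewrite ltNge; apply/negP => H; have := ler_pM (ltW p0) (ltW p0) H H; nra.
apply: divr_gt0 => //; apply: sin_gt0_pi; apply/andP; split; first exact: mulr_gt0.
by apply: le_lt_trans swpi; rewrite -[leRHS]mul1r ler_wpM2r// ltW.
Qed.

(** With the next two lemmas, this absorbs the conventions of the statement at [w = 0] into the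
    single one in [sn]. *)
Lemma hcotE w : 0 <= w -> hcot w = cs 1 w / sn 1 w.
Proof.
move=> w0; rewrite /hcot /cs /sn mul1r; case: ifPn => [/eqP ->|wn0].
  by rewrite sqrtr0 cos0 divr1.
by rewrite invf_div; ring.
Qed.

Lemma hsinqE s w : 0 <= w -> hsinq s w = sn s w / sn 1 w.
Proof.
move=> w0; rewrite /hsinq /sn mul1r; case: ifPn => wn0.
  by rewrite divr1.
by rewrite invf_div mulrA divfK// sqrtr_neq0.
Qed.

Lemma hzsinE w : 0 <= w -> hzsin w = (sn 1 w)^-1.
Proof.
move=> w0; rewrite /hzsin /sn mul1r; case: ifPn => wn0.
  by rewrite invr1.
by rewrite invf_div.
Qed.

(** The symbol of the matrix C(s) of the overview. *)
Definition ct s w : R := cs s w / sn s w.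

Lemma is_derive_snV s w : 0 <= w -> sn s w != 0 ->
  is_derive s 1 (fun t => (sn t w)^-1) (- ct s w / sn s w).
Proof.
move=> w0 sn_n0; apply: is_derive_eq (@is_deriveV R (sn^~ w) s _ 1 sn_n0 (is_derive_sn s w0)) _.
by rewrite /ct /GRing.scale /=; field.
Qed.

Lemma is_derive_ct s w : 0 <= w -> sn s w != 0 ->
  is_derive s 1 (ct^~ w) (- (ct s w ^+ 2 + w)).
Proof.
move=> w0 sn_n0.
apply: is_derive_eq (is_deriveM (is_derive_cs s w0) (is_derive_snV w0 sn_n0)) _.
rewrite /ct /GRing.scale /=; by field.
Qed.

End TrigScalars.

(** * Functions of a skew-symmetric matrix *)

Section SkewExponential.
Variables (R : realType).

Lemma cvg_series_lincomb (I : finType) (c : I -> R) (g : I -> nat -> R) (L : I -> R) :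
  (forall i, series (g i) @ \oo --> L i) ->
  series (fun k => \sum_i c i * g i k) @ \oo --> \sum_i c i * L i.
Proof.
move=> gL.
have -> : series (fun k => \sum_i c i * g i k) = (fun m => \sum_i c i * series (g i) m).
  apply/funext => m; rewrite /series /= exchange_big /=.
  by apply: eq_bigr => i _; rewrite mulr_sumr.
elim: (index_enum I) => [|i r IH].
  rewrite big_nil; under eq_fun do rewrite big_nil; exact: cvg_cst.
rewrite big_cons; under eq_fun do rewrite big_cons.
by apply: cvgD => //; apply: cvgM => //; exact: cvg_cst.
Qed.

Variables (n : nat) (B : 'M[R]_n).
Hypothesis Bskew : B^T = - B.
Local Notation W := (- (B *m B)).

Lemma skew_sq_sym : W^T = W.
Proof. by rewrite linearN /= trmx_mul Bskew mulNmx mulmxN opprK. Qed.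

Lemma skew_sq_dotv x y : dotv (mxv W x) y = dotv (mxv B x) (mxv B y).
Proof. by rewrite mxvNl mxvM dotvNl (skew_dotv _ _ Bskew) opprK. Qed.

Lemma skew_sq_eigen_ge0 w : eigen W w -> 0 <= w.
Proof.
move=> [v v0 vw]; have := dotv_ge0 (mxv B v).
rewrite -skew_sq_dotv vw dotvZl pmulr_lge0// lt_def dotv_ge0 andbT.
by apply: contra_neq v0 => /dotv_eq0.
Qed.

Lemma skew_mxfun_comm h : B *m mxfun h W = mxfun h W *m B.
Proof. by apply: (mxfun_comm skew_sq_sym); rewrite mulmxN mulNmx mulmxA. Qed.

Definition sncoeff s w : nat -> R :=
  if w == 0 then (fun k => s *+ (k == 1%N)) else
  (fun k => (Num.sqrt w)^-1 * sin_coeff (s * Num.sqrt w) k).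

Lemma cvg_sncoeff s w : series (sncoeff s w) @ \oo --> sn s w.
Proof.
rewrite /sncoeff /sn; case: ifPn => w0.
  apply: cvg_near_cst.
  near=> m; have m2 : (1 < m)%N by near: m; exact: nbhs_infty_gt.
  rewrite /series/= (big_cat_nat _ (n := 2))//= big_nat_recr//= big_nat1 add0r big_nat_cond big1 ?addr0//.
  by move=> k /andP[/andP[k2 _] _]; rewrite gtn_eqF.
have -> : series (fun k => (Num.sqrt w)^-1 * sin_coeff (s * Num.sqrt w) k) =
   (fun m => (Num.sqrt w)^-1 * series (sin_coeff (s * Num.sqrt w)) m).
  by apply/funext => m; rewrite /series/= mulr_sumr.
rewrite [sin _ / _]mulrC; apply: cvgM; first exact: cvg_cst.
by rewrite sin.unlock; exact: is_cvg_series_sin_coeff.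
Unshelve. all: by end_near. Qed.

(** Since B^2 = - W, the even powers of [s *: B] carry the cosine series of s sqrt W, and the odd
    ones B times the series of [sn]. Expanding in the matrices [E l] leaves one scalar series per
    eigenvalue. *)
Lemma skew_expE s : expmx (s *: B) = mxfun (cs s) W + B *m mxfun (sn s) W.
Proof.
have [E [d [de H]]] := mxfun_sum skew_sq_sym.
have d0 l : 0 <= d l by exact: skew_sq_eigen_ge0.
have W_pow k : W ^+ k = \sum_l d l ^+ k *: E l.
  rewrite -(H (fun w => w ^+ k)); elim: k => [|k IH].
    by rewrite expr0; apply/esym; rewrite -[RHS](mxfun1 skew_sq_sym).
  rewrite exprS IH -[X in X * _](mxfun_id skew_sq_sym) -[LHS]/(_ *m _) (mxfunM skew_sq_sym).
  by congr (mxfun _ W); apply/funext => w; rewrite exprS.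
have ZX (c : R) (A : 'M[R]_n) k : (c *: A) ^+ k = c ^+ k *: A ^+ k.
  elim: k => [|k IH]; first by rewrite !expr0 scale1r.
  by rewrite !exprS IH -[LHS]/(_ *m _) -scalemxAl -scalemxAr scalerA.
have even_pow k : (s *: B) ^+ k.*2 = \sum_l ((-1) ^+ k * s ^+ k.*2 * d l ^+ k) *: E l.
  rewrite -muln2 mulnC exprM expr2.
  have -> : (s *: B) * (s *: B) = (- s ^+ 2) *: W.
    rewrite -[LHS]/(_ *m _) -scalemxAl -scalemxAr scalerA scalerN scaleNr opprK -expr2 //.
  rewrite ZX W_pow scaler_sumr; apply: eq_bigr => l _; rewrite scalerA; congr (_ *: _).
  by rewrite [(- s ^+ 2) ^+ k]exprNn [s ^+ (2 * k)]exprM.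
have odd_pow k : (s *: B) ^+ k.*2.+1 =
    \sum_l ((-1) ^+ k * s ^+ k.*2.+1 * d l ^+ k) *: (B *m E l).
  rewrite exprS even_pow -[LHS]/(_ *m _) -scalemxAl mulmx_sumr scaler_sumr.
  apply: eq_bigr => l _; rewrite -scalemxAr scalerA exprS; congr (_ *: _); ring.
apply/matrixP => i j; rewrite mxE.
apply/cvg_lim => //.
rewrite [_ i j]mxE !H summxE mulmx_sumr summxE.
pose c l := E l i j; pose e l := (B *m E l) i j.
have -> : (fun k => ((s *: B) ^+ k) i j / k`!%:R) =
   (fun k => \sum_l c l * cos_coeff (s * Num.sqrt (d l)) k) \+ (fun k => \sum_l e l * sncoeff s (d l) k).
  apply/funext => k /=; have [ok|ek] := boolP (odd k); last first.
    have kE : k = k./2.*2 by rewrite -[LHS]odd_double_half (negbTE ek).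
    rewrite [X in _ + X]big1 ?addr0; last first.
      move=> l _; rewrite /sncoeff; case: ifP => _; last by rewrite kE sin_coeff_even !mulr0.
      suff -> : (k == 1%N) = false by rewrite mulr0n mulr0.
      by apply/negbTE; apply: contra ek => /eqP ->.
    rewrite kE even_pow summxE mulr_suml; apply: eq_bigr => l _.
    rewrite /cos_coeff /= odd_double /= mul1r doubleK mxE /c exprMn.
    have -> : Num.sqrt (d l) ^+ k./2.*2 = d l ^+ k./2.
      by rewrite -muln2 mulnC exprM sqr_sqrtr.
    by rewrite -exprnP; ring.
  have kE : k = k./2.*2.+1 by rewrite -[LHS]odd_double_half ok.
  rewrite [X in X + _]big1 ?add0r; last first.
    by move=> l _; rewrite kE cos_coeff_odd mulr0.
  rewrite kE odd_pow summxE mulr_suml.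
  apply: eq_bigr => l _; rewrite mxE -/(e l) /sncoeff.
  (* For the eigenvalue 0 only the power k = 1 contributes. *)
  case: ifPn => [/eqP ->|dl0].
    case: (k./2) => [|m]; first by rewrite !expr0 double0 expr1 eqxx !mulr1n divr1; ring.
    by rewrite [0 ^+ _]exprS mul0r mulr0 !mul0r doubleS /= mulr0n mulr0.
  rewrite /sin_coeff /= odd_double /= mul1r doubleK exprMn.
  have -> : Num.sqrt (d l) ^+ k./2.*2.+1 = Num.sqrt (d l) * d l ^+ k./2.
    by rewrite exprS -muln2 mulnC exprM sqr_sqrtr.
  have := sqrtr_neq0 (d0 l) dl0 => ?.
  rewrite exprS; field.
  by rewrite pnatr_eq0 -lt0n fact_gt0.
have -> : forall u v : nat -> R, series (u \+ v) = series u \+ series v.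
  by move=> u v; apply/funext => m; rewrite /series/= big_split.
apply: cvgD.
- have -> : \sum_l (cs s (d l) *: E l) i j = \sum_l c l * cs s (d l).
    by apply: eq_bigr => l _; rewrite mxE mulrC.
  apply: cvg_series_lincomb => l; rewrite /cs cos.unlock; exact: is_cvg_series_cos_coeff.
- have -> : \sum_l (B *m (sn s (d l) *: E l)) i j = \sum_l e l * sn s (d l).
    by apply: eq_bigr => l _; rewrite -scalemxAr mxE mulrC.
  apply: cvg_series_lincomb => l; exact: cvg_sncoeff.
Qed.

End SkewExponential.

(** * The explicit trajectory of one skew-symmetric matrix *)

Section SkewTrajectories.
Variables (R : realType) (n : nat) (B : 'M[R]_n).
Hypothesis Bskew : B^T = - B.
Local Notation W := (- (B *m B)).
Hypothesis W_lt_pi2 : forall w, eigen W w -> w < pi ^+ 2.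
Let Wsym := skew_sq_sym Bskew.
Let Wge0 := skew_sq_eigen_ge0 Bskew.

Lemma vderD (x y x' y' : R -> 'rV[R]_n) : vder x x' -> vder y y' ->
  vder (fun s => x s + y s) (fun s => x' s + y' s).
Proof.
move=> xD yD i s; have := is_deriveD (xD i s) (yD i s).
rewrite mxE; congr is_derive; by apply/funext => r; rewrite mxE.
Qed.

Lemma vderZ k (x x' : R -> 'rV[R]_n) : vder x x' ->
  vder (fun s => k *: x s) (fun s => k *: x' s).
Proof.
move=> xD i s; have := is_deriveZ k (xD i s).
rewrite mxE; congr is_derive; by apply/funext => r; rewrite mxE.
Qed.

Lemma vder_mxv (A : 'M[R]_n) (x x' : R -> 'rV[R]_n) : vder x x' ->
  vder (fun s => mxv A (x s)) (fun s => mxv A (x' s)).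
Proof.
move=> xD i s.
have -> : (fun s => mxv A (x s) 0 i) = \sum_j (A i j *: (fun s => x s 0 j)).
  by apply/funext => r; rewrite fct_sumE mxvE.
rewrite mxvE; apply: is_derive_sum => j; apply: is_deriveZ; exact: xD.
Qed.

(* a(W) + B b(W): the matrix whose symbol on the eigenvalue w is a(w) + i sqrt(w) b(w) *)
Definition skewfun (a b : R -> R) : 'M[R]_n := mxfun a W + B *m mxfun b W.

Lemma eq_skewfun a b c d : (forall w, eigen W w -> a w = c w) ->
  (forall w, eigen W w -> b w = d w) -> skewfun a b = skewfun c d.
Proof. by move=> ac bd; rewrite /skewfun (eq_mxfun Wsym ac) (eq_mxfun Wsym bd). Qed.

(** Symbols multiply as complex numbers, because B^2 = - W and B commutes with every function of
    W. *)
Lemma skewfunM a b c d : skewfun a b *m skewfun c d =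
  skewfun (fun w => a w * c w - w * b w * d w) (fun w => a w * d w + b w * c w).
Proof.
have comm := skew_mxfun_comm Bskew.
rewrite /skewfun mulmxDl !mulmxDr (mulmxA (mxfun a W) B) -comm -!mulmxA !(mxfunM Wsym).
have -> : B *m (mxfun b W *m (B *m mxfun d W)) = - mxfun (fun w => w * b w * d w) W.
  rewrite (mulmxA (mxfun b W)) -comm -!mulmxA (mxfunM Wsym) mulmxA.
  transitivity (- (mxfun id W *m mxfun (fun w => b w * d w) W)).
    by rewrite (mxfun_id Wsym) mulNmx opprK.
  rewrite (mxfunM Wsym); congr (- mxfun _ _).
  by apply/funext => w; rewrite mulrA.
rewrite (mxfunN Wsym) -(mxfunD Wsym (fun w => a w * c w)) -(mxfunD Wsym (fun w => a w * d w)).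
by rewrite mulmxDr -!addrA; congr (_ + _); rewrite addrA addrC.
Qed.

Lemma skewfun1 : skewfun (fun=> 1) (fun=> 0) = 1%:M.
Proof.
by rewrite /skewfun (mxfun1 Wsym) (mxfun0 Wsym) mulmx0 addr0.
Qed.

Lemma skewfunB : skewfun (fun=> 0) (fun=> 1) = B.
Proof. by rewrite /skewfun (mxfun1 Wsym) (mxfun0 Wsym) mulmx1 add0r. Qed.

Lemma skewfunZ k a b : k *: skewfun a b = skewfun (fun w => k * a w) (fun w => k * b w).
Proof. by rewrite /skewfun scalerDr scalemxAr !(mxfunZ Wsym). Qed.

Lemma vder_skewfun (a a' b b' : R -> R -> R) (u : 'rV[R]_n) :
  (forall w, eigen W w -> forall s : R, is_derive s 1 (a^~ w) (a' s w)) ->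
  (forall w, eigen W w -> forall s : R, is_derive s 1 (b^~ w) (b' s w)) ->
  vder (fun s => mxv (skewfun (a s) (b s)) u) (fun s => mxv (skewfun (a' s) (b' s)) u).
Proof.
move=> aD bD; rewrite /skewfun.
have := vderD (vder_mxfun Wsym u aD) (vder_mxv B (vder_mxfun Wsym u bD)).
by congr vder; apply/funext => s; rewrite mxvDl mxvM.
Qed.

Lemma sn1_gt0 w : eigen W w -> 0 < sn 1 w.
Proof. by move=> we; apply: sn_gt0 => //; [exact: Wge0|exact: W_lt_pi2]. Qed.

Variable x0 : 'rV[R]_n.

(** [traj] and [vel] have the bodies of [gx] and [gzeta] with an arbitrary skew-symmetric matrix for
    [Ut U theta0]: [gamma0E] then holds by conversion, and the matrix can be perturbed freely. *)
Definition traj s := mxv (mxfun (hsinq s) W) (mxv (expmx ((s - 1) *: B)) x0).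
Definition vel s := mxv (mxfun (@hzsin R) W) (mxv (expmx ((2 * s - 1) *: B)) x0).

Lemma mxfun_skewfunM h a b :
  mxfun h W *m skewfun a b = skewfun (fun w => h w * a w) (fun w => h w * b w).
Proof.
rewrite /skewfun mulmxDr mulmxA -(skew_mxfun_comm Bskew) -mulmxA !(mxfunM Wsym) //.
Qed.

Lemma trajE s : traj s = mxv (skewfun
  (fun w => sn s w * cs (s - 1) w / sn 1 w) (fun w => sn s w * sn (s - 1) w / sn 1 w)) x0.
Proof.
rewrite /traj (skew_expE Bskew) -/(skewfun _ _) -mxvM mxfun_skewfunM; congr mxv.
by apply: eq_skewfun => w /Wge0 w0; rewrite hsinqE// mulrAC.
Qed.

Lemma velE s : vel s = mxv (skewfun
  (fun w => cs (2 * s - 1) w / sn 1 w) (fun w => sn (2 * s - 1) w / sn 1 w)) x0.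
Proof.
rewrite /vel (skew_expE Bskew) -/(skewfun _ _) -mxvM mxfun_skewfunM; congr mxv.
by apply: eq_skewfun => w /Wge0 w0; rewrite hzsinE// mulrC.
Qed.

Lemma vder_traj : vder traj vel.
Proof.
rewrite (funext trajE) (funext velE).
have e2 s : 2 * s - 1 = s + (s - 1) :> R by ring.
apply: vder_skewfun => w we s; have w0 := Wge0 we; have sn1 := lt0r_neq0 (sn1_gt0 we).
  have C1 : is_derive s 1 (fun t => cs (t - 1) w) (- w * sn (s - 1) w).
    have := is_derive_cs_affine 1 1 s w0; rewrite mul1r mulr1.
    by congr is_derive; apply/funext => r; rewrite mul1r.
  have := is_deriveM (is_deriveM (is_derive_sn s w0) C1) (is_derive_cst ((sn 1 w)^-1) s 1).
  move=> /is_derive_eq; apply; rewrite e2 (csD s (s - 1))// /GRing.scale /=; by field.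
have C1 : is_derive s 1 (fun t => sn (t - 1) w) (cs (s - 1) w).
  have := is_derive_sn_affine 1 1 s w0; rewrite mul1r mulr1.
  by congr is_derive; apply/funext => r; rewrite mul1r.
have := is_deriveM (is_deriveM (is_derive_sn s w0) C1) (is_derive_cst ((sn 1 w)^-1) s 1).
move=> /is_derive_eq; apply; rewrite e2 (snD s (s - 1))// /GRing.scale /=; by field.
Qed.

Lemma vder_vel : vder vel (fun s => 2 *: mxv B (vel s)).
Proof.
have -> : (fun s => 2 *: mxv B (vel s)) = (fun s => mxv (skewfun
   (fun w => - 2 * w * sn (2 * s - 1) w / sn 1 w) (fun w => 2 * cs (2 * s - 1) w / sn 1 w)) x0).
  apply/funext => s; rewrite velE -mxvM -{1}skewfunB skewfunM -mxvZl skewfunZ; congr mxv.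
  by apply: eq_skewfun => w _; ring.
rewrite (funext velE).
apply: vder_skewfun => w we s; have w0 := Wge0 we; have sn1 := lt0r_neq0 (sn1_gt0 we).
  have := is_deriveM (is_derive_cs_affine 2 1 s w0) (is_derive_cst ((sn 1 w)^-1) s 1).
  move=> /is_derive_eq; apply; rewrite /GRing.scale /=; by field.
have := is_deriveM (is_derive_sn_affine 2 1 s w0) (is_derive_cst ((sn 1 w)^-1) s 1).
move=> /is_derive_eq; apply; rewrite /GRing.scale /=; by field.
Qed.

Lemma traj0 : traj 0 = 0.
Proof.
rewrite trajE /skewfun.
have z := mxfun0 Wsym.
rewrite (_ : mxfun _ W = 0); last by rewrite -z; congr mxfun; apply/funext => w; rewrite sn0 !mul0r.
rewrite (_ : mxfun _ W = 0); last by rewrite -z; congr mxfun; apply/funext => w; rewrite sn0 !mul0r.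
by rewrite mulmx0 addr0 /mxv trmx0 mulmx0.
Qed.

Lemma traj1 : traj 1 = x0.
Proof.
rewrite trajE -[RHS]mxv1 -skewfun1; congr mxv; apply: eq_skewfun => w we.
  by rewrite subrr cs0 mulr1 divff// lt0r_neq0// sn1_gt0.
by rewrite subrr sn0 mulr0 mul0r.
Qed.

(** Half the horizontal gradient of the calibration F: the term 4 t.tau contributes 2 B x, since t'
    = <U x, x'> / 2. *)
Definition momentum s x := mxv (mxfun (ct s) W) x + mxv B x.

Lemma mxfun_ct_B s : mxfun (ct s) W + B = skewfun (ct s) (fun=> 1).
Proof. by rewrite /skewfun (mxfun1 Wsym) mulmx1. Qed.

(** On symbols, with r = sqrt w: (ct + i r) sn = cs + i r sn = exp(i s r), and multiplying by exp(i
    (s - 1) r) gives exp(i (2 s - 1) r). At s = 0 the factor [ct] is singular. *)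
Lemma vel_momentum s : 0 < s <= 1 -> vel s = momentum s (traj s).
Proof.
move=> /andP[s0 s1].
rewrite /momentum -mxvDl mxfun_ct_B velE trajE -mxvM skewfunM; congr mxv.
have e2 : 2 * s - 1 = s + (s - 1) :> R by ring.
apply: eq_skewfun => w we; have w0 := Wge0 we; have sn1 := lt0r_neq0 (sn1_gt0 we);
  have sns := lt0r_neq0 (sn_gt0 w0 (W_lt_pi2 we) s0 s1); rewrite /ct e2.
  by rewrite (csD s (s - 1))//; field; rewrite sn1 sns.
by rewrite (snD s (s - 1))//; field; rewrite sn1 sns.
Qed.

(** Identifies the trajectory as the normal geodesic with initial velocity [vel 0]. *)
Lemma vel_exp s : vel s = mxv (expmx ((2 * s) *: B)) (vel 0).
Proof.
rewrite (skew_expE Bskew) -/(skewfun _ _) !velE -mxvM skewfunM; congr mxv.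
apply: eq_skewfun => w we; have w0 := Wge0 we; have sn1 := lt0r_neq0 (sn1_gt0 we).
  by rewrite mulr0 sub0r csD//; field.
by rewrite mulr0 sub0r snD//; field.
Qed.

(** Writes the quadratic part of phi through the endpoint velocity, the form in which two values of
    tau are compared by integration by parts. *)
Lemma ucot_vel1 : dotv (mxv (mxfun (@hcot R) W) x0) x0 = dotv (vel 1) x0.
Proof.
rewrite vel_momentum ?ltr01 ?lexx// traj1 /momentum dotvDl (skew_dotv0 _ Bskew) addr0.
by congr (dotv (mxv _ _) _); apply: (eq_mxfun Wsym) => w /Wge0 w0; rewrite hcotE.
Qed.

Lemma vel_sqnorm s : 0 <= s <= 1 -> dotv (vel s) (vel s) = dotv (vel 0) (vel 0).
Proof.
move=> /andP[s0 s1].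
have vA : vAC 0 1 vel (fun s => 2 *: mxv B (vel s)).
  by apply: (vAC_vder ler01 vder_vel); exact: vderZ (vder_mxv B vder_vel).
have := (AC_dotv (n:=n) ler01 vA vA).2 s; rewrite s0 s1 => /(_ isT) ->.
rewrite (@Rint_ext _ _ _ _ (fun=> 0)) ?Rint_cst// ?mulr0 ?addr0//.
by move=> r _; rewrite dotvZl dotvZr (dotvC (vel r)) skew_dotv0// mulr0 addr0.
Qed.

(** * Calibration *)

Lemma mxfun_ct_comm s : mxfun (ct s) W *m B = B *m mxfun (ct s) W.
Proof. by rewrite (skew_mxfun_comm Bskew). Qed.

(** The cross term vanishes: C is symmetric and commutes with B, so C B is skew. What remains is the
    quadratic form of C^2 + W, the Riccati term in the derivative of F. *)
Lemma momentum_sqnorm s x : dotv (momentum s x) (momentum s x) =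
  dotv (mxv (mxfun (fun w => ct s w ^+ 2 + w) W) x) x.
Proof.
set C := mxfun (ct s) W.
have cross : dotv (mxv C x) (mxv B x) = 0.
  have : dotv (mxv C x) (mxv B x) = - dotv (mxv C x) (mxv B x).
    rewrite [LHS]dotv_mxv (mxfun_trmx Wsym) -mxvM mxfun_ct_comm mxvM -[LHS]opprK.
    by congr (- _); rewrite -(skew_dotv _ _ Bskew) dotvC.
  lra.
rewrite /momentum -/C !(dotvDl, dotvDr) cross (dotvC (mxv B x)) cross addr0 add0r.
rewrite -(skew_sq_dotv Bskew).
rewrite -(mxfunD Wsym (fun w => ct s w ^+ 2) id) mxvDl dotvDl (mxfun_id Wsym); congr (_ + _).
have -> : mxfun (fun w => ct s w ^+ 2) W = C *m C by rewrite (mxfunM Wsym).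
by rewrite mxvM [RHS]dotv_mxv (mxfun_trmx Wsym).
Qed.

Lemma momentumB s x y : momentum s (x - y) = momentum s x - momentum s y.
Proof. by rewrite /momentum !mxvBr opprD addrACA. Qed.

(** Zero is excluded because [ct] and the inverse of [sn] blow up there. *)
Definition in01 (y : R) := 0 < y <= 1.

Lemma sn_neq0 s w : in01 s -> eigen W w -> sn s w != 0.
Proof. by move=> /andP[s0 s1] we; apply/lt0r_neq0/sn_gt0 => //; [exact: Wge0|exact: W_lt_pi2]. Qed.

Lemma in01_convex y z w : in01 y -> in01 z -> y <= w <= z -> in01 w.
Proof. by move=> /andP[y0 _] /andP[_ z1] /andP[yw wz]; apply/andP; split; lra. Qed.

Lemma is_derive_continuous (h : R -> R) (y dh : R) : is_derive y 1 h dh -> {for y, continuous h}.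
Proof. by move=> [hd _]; apply: differentiable_continuous; apply/derivable1_diffP. Qed.

Lemma AC_ct a b sigma sigma' w : a <= b -> AC a b sigma sigma' ->
  (forall r, a <= r <= b -> in01 (sigma r)) -> eigen W w ->
  AC a b (fun r => ct (sigma r) w) (fun r => - (ct (sigma r) w ^+ 2 + w) * sigma' r).
Proof.
move=> ab sA s01 we; have w0 := Wge0 we.
apply: (AC_comp (P := in01) (h := fun s => ct s w) (h' := fun s => - (ct s w ^+ 2 + w))) => //.
- exact: in01_convex.
- by move=> y y01; apply: is_derive_ct => //; exact: sn_neq0.
- move=> y y01; have D := is_derive_ct w0 (sn_neq0 y01 we).
  exact: is_derive_continuous.
Qed.

Lemma AC_snV a b sigma sigma' w : a <= b -> AC a b sigma sigma' ->
  (forall r, a <= r <= b -> in01 (sigma r)) -> eigen W w ->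
  AC a b (fun r => (sn (sigma r) w)^-1) (fun r => (- ct (sigma r) w / sn (sigma r) w) * sigma' r).
Proof.
move=> ab sA s01 we; have w0 := Wge0 we.
apply: (AC_comp (P := in01) (h := fun s => (sn s w)^-1) (h' := fun s => - ct s w / sn s w)) => //.
- exact: in01_convex.
- by move=> y y01; apply: is_derive_snV => //; exact: sn_neq0.
- move=> y y01; have D := is_derive_ct w0 (sn_neq0 y01 we).
  apply: is_derive_continuous.
  exact: is_deriveM (is_deriveN D) (is_derive_snV w0 (sn_neq0 y01 we)).
Qed.

Lemma mxfunZr k h : mxfun (fun w => h w * k) W = k *: mxfun h W.
Proof. by rewrite (mxfunZ Wsym); apply: (eq_mxfun Wsym) => w _; rewrite mulrC. Qed.

(** [T] stands for 4 t.tau along the curve. Kept abstract, it lets the calibration apply to curves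
    in R^q without a point of the group attached, as in [loop_inequality]. *)
Lemma calibration_AC a b (x v : R -> 'rV[R]_n) sigma sigma' T : a <= b ->
  vAC a b x v -> AC a b sigma sigma' -> (forall r, a <= r <= b -> in01 (sigma r)) ->
  AC a b T (fun r => 2 * dotv (mxv B (x r)) (v r)) ->
  AC a b (fun r => dotv (mxv (mxfun (ct (sigma r)) W) (x r)) (x r) + T r)
    (fun r => 2 * dotv (momentum (sigma r) (x r)) (v r)
              - sigma' r * dotv (momentum (sigma r) (x r)) (momentum (sigma r) (x r))).
Proof.
move=> ab xA sA s01 TA.
have CA := vAC_mxfun Wsym ab (fun w we => AC_ct ab sA s01 we) xA.
have := ACD (AC_dotv ab CA xA) TA.
apply: AC_ext' => r _.
rewrite momentum_sqnorm mxfunZr mxvZl dotvDl dotvZl.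
rewrite -(mxfunN Wsym) mxvNl dotvNl /momentum dotvDl.
rewrite [dotv (mxv (mxfun (ct (sigma r)) W) (v r)) (x r)]dotv_mxv (mxfun_trmx Wsym).
rewrite (dotvC (v r)); ring.
Qed.

Lemma vAC_momentum a b (x v : R -> 'rV[R]_n) sigma sigma' : a <= b ->
  vAC a b x v -> AC a b sigma sigma' -> (forall r, a <= r <= b -> in01 (sigma r)) ->
  exists p', vAC a b (fun r => momentum (sigma r) (x r)) p'.
Proof.
move=> ab xA sA s01.
have CA := vAC_mxfun Wsym ab (fun w we => AC_ct ab sA s01 we) xA.
by have := vACD CA (vAC_mxv B xA); eexists; eassumption.
Qed.

(** The clock runs from S - length / L to S, and the strict bound on the length makes its starting
    value positive, away from the singularity of [ct]. The value of the calibration at r = 0 is zero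
    whatever that starting value, because x and T vanish there. *)
Lemma calibration_le_aux (b S L : R) (x v : R -> 'rV[R]_n) T : 0 <= b -> 0 < S <= 1 ->
  0 < L -> Rint 0 b (fun r => enorm (v r)) < L * S ->
  vAC 0 b x v -> x 0 = 0 -> T 0 = 0 ->
  AC 0 b T (fun r => 2 * dotv (mxv B (x r)) (v r)) ->
  dotv (mxv (mxfun (ct S) W) (x b)) (x b) + T b <= L * Rint 0 b (fun r => enorm (v r)).
Proof.
move=> b0 /andP[S0 S1] L0 ellL xA x0' T0 TA.
pose N r := enorm (v r).
have Ni : integrable_on 0 b N by apply: measurable_enorm => i; exact: (xA i).1.
pose ell := Rint 0 b N; rewrite -/N -/ell in ellL *.
have NA := AC_int 0 Ni.
(* speed N / L is the choice that makes 2 <p, v> - sigma' |p|^2 <= L N an instance of AM-GM *)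
pose sigma r := (S - L^-1 * ell) + L^-1 * (0 + Rint 0 r N).
have sA : AC 0 b sigma (fun r => 0 + L^-1 * N r).
  by apply: ACD; [exact: AC_cst|exact: ACZ].
have sigma_b : sigma b = S by rewrite /sigma add0r -/ell subrK.
have N0 r : 0 <= N r by exact: enorm_ge0.
have s01 r : 0 <= r <= b -> in01 (sigma r).
  move=> /andP[r0 rb].
  have R0 : 0 <= Rint 0 r N by apply: Rintegral_ge0.
  have Rb : Rint 0 r N <= ell.
    by rewrite /ell (Rint_cat r0 rb Ni) lerDl; apply: Rintegral_ge0.
  have Li : 0 < L^-1 by rewrite invr_gt0.
  have : L^-1 * ell < S by rewrite mulrC ltr_pdivrMr// mulrC.
  have : L^-1 * Rint 0 r N <= L^-1 * ell by rewrite ler_pM2l.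
  have : 0 <= L^-1 * Rint 0 r N by rewrite mulr_ge0// ltW.
  by rewrite /in01 /sigma => ? ? ?; apply/andP; split; lra.
have := AC_le b0 (calibration_AC b0 xA sA s01 TA) (ACZ L NA).
rewrite sigma_b x0' T0 mxv0 dot0v Rint_id -/ell.
suff H : forall s, 0 <= s <= b -> 2 * dotv (momentum (sigma s) (x s)) (v s) -
     (0 + L^-1 * N s) * dotv (momentum (sigma s) (x s)) (momentum (sigma s) (x s)) <= L * N s.
  by move=> /(_ H); lra.
move=> s _; set p := momentum _ _.
have CS := cauchy_schwarz p (v s); rewrite -/(N s) in CS.
rewrite -enorm_sqr; have P0 := enorm_ge0 p; have := N0 s.
set P := enorm p in CS P0 *; set M := N s in CS * => M0.
have : 0 <= L^-1 * M * (P - L) ^+ 2 by rewrite mulr_ge0 ?sqr_ge0// mulr_ge0// invr_ge0 ltW.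
have -> : L^-1 * M * (P - L) ^+ 2 = L^-1 * M * P ^+ 2 - 2 * P * M + L * M.
  by field; rewrite lt0r_neq0.
lra.
Qed.

(** Lets L in [calibration_le_aux] decrease to length / S. A general final clock value S is kept
    because the equality case applies the bound to an initial piece [0, r0], with S the fraction of
    arc length used there. *)
Lemma calibration_le (b S : R) (x v : R -> 'rV[R]_n) T : 0 <= b -> 0 < S <= 1 ->
  vAC 0 b x v -> x 0 = 0 -> T 0 = 0 ->
  AC 0 b T (fun r => 2 * dotv (mxv B (x r)) (v r)) ->
  S * (dotv (mxv (mxfun (ct S) W) (x b)) (x b) + T b) <= Rint 0 b (fun r => enorm (v r)) ^+ 2.
Proof.
move=> b0 S01 xA x0' T0 TA; have /andP[S0 S1] := S01.
set ell := Rint _ _ _; have ell0 : 0 <= ell by apply: Rintegral_ge0 => r _; exact: enorm_ge0.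
apply/ler_addgt0Pr => e e0.
(* The [+ 1] covers a curve of length zero. *)
pose d := e / (ell + 1); have d0 : 0 < d by rewrite divr_gt0//; lra.
have := @calibration_le_aux b S (ell / S + d / S) x v T b0 S01.
rewrite -/ell => /(_ _ _ xA x0' T0 TA) H.
have {H} : dotv (mxv (mxfun (ct S) W) (x b)) (x b) + T b <= (ell / S + d / S) * ell.
  apply: H.
    by apply: ltr_wpDl; [exact: divr_ge0 (ltW S0)|exact: divr_gt0].
  have -> : (ell / S + d / S) * S = ell + d by field; rewrite lt0r_neq0.
  lra.
rewrite -(ler_pM2l S0) => /le_trans; apply.
have -> : S * ((ell / S + d / S) * ell) = ell ^+ 2 + d * ell by field; rewrite lt0r_neq0.
rewrite lerD2l /d -mulrA -[leRHS]mulr1 ler_wpM2l ?(ltW e0)// mulrC ler_pdivrMr; lra.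
Qed.

Lemma Rint_dotv_null m a b (k k' w : R -> 'rV[R]_m) : a <= b -> vAC a b k k' ->
  (forall i, integrable_on a b (fun r => w r 0 i)) ->
  Rint a b (fun r => enorm (w r)) = 0 ->
  integrable_on a b (fun r => dotv (k r) (w r)) /\ Rint a b (fun r => dotv (k r) (w r)) = 0.
Proof.
move=> ab kA wi w0.
have ck i := AC_continuous ab (kA i).
have ki i := integrable_onM (ck i) (wi i).
split; first exact: integrable_on_sum ki.
rewrite /dotv Rint_sum// big1// => i _; apply: Rint_mul_null => //.
apply/eqP; rewrite eq_le -{1}w0; apply/andP; split; last by apply: Rintegral_ge0.
apply: Rint_le => [||r _]; last exact: abs_coord_le_enorm.
  exact: integrable_on_norm.
exact: measurable_enorm.
Qed.

(** * Rigidity of curves attaining equality *)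

Section EqualityCase.
Variables (x v : R -> 'rV[R]_n) (T : R -> R).
Hypotheses (xA : vAC 0 1 x v) (x_0 : x 0 = 0) (x_1 : x 1 = x0) (T_0 : T 0 = 0).
Hypothesis TA : AC 0 1 T (fun r => 2 * dotv (mxv B (x r)) (v r)).
Let N r := enorm (v r).
Let ell := Rint 0 1 N.
Hypothesis ell0 : 0 < ell.
Hypothesis ell2 : dotv (mxv (mxfun (@hcot R) W) x0) x0 + T 1 = ell ^+ 2.
Let sigma r := ell^-1 * Rint 0 r N.
Let defect r := v r - (ell^-1 * N r) *: momentum (sigma r) (x r).

Let N0 r : 0 <= N r. Proof. exact: enorm_ge0. Qed.

Let Ni : integrable_on 0 1 N.
Proof. by apply: measurable_enorm => i; exact: (xA i).1. Qed.

Lemma arclength_AC : AC 0 1 sigma (fun r => ell^-1 * N r).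
Proof.
apply: AC_ext (ACZ ell^-1 (AC_int 0 Ni)) => s _; by rewrite add0r.
Qed.

Lemma arclength_mono r s : 0 <= r -> r <= s -> s <= 1 -> sigma r <= sigma s.
Proof.
move=> r0 rs s1; rewrite -subr_ge0 (AC_diff arclength_AC)//.
by apply: Rintegral_ge0 => t _; rewrite mulr_ge0// invr_ge0 ltW.
Qed.

Lemma arclength0 : sigma 0 = 0.
Proof. by rewrite /sigma Rint_id mulr0. Qed.

Lemma arclength1 : sigma 1 = 1.
Proof. by rewrite /sigma -/ell mulVf// lt0r_neq0. Qed.

Section PositiveArclength.
Variable r0 : R.
Hypotheses (r00 : 0 <= r0) (r01 : r0 <= 1) (sr0 : 0 < sigma r0).

Let s01 r : r0 <= r <= 1 -> in01 (sigma r).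
Proof.
move=> /andP[r0r r1]; apply/andP; split.
  by apply: lt_le_trans sr0 _; exact: arclength_mono.
by rewrite -[leRHS]arclength1; apply: arclength_mono => //; exact: le_trans r00 r0r.
Qed.

Let xA' : vAC r0 1 x v. Proof. exact: vAC_sub xA. Qed.
Let sA' : AC r0 1 sigma (fun r => ell^-1 * N r). Proof. exact: AC_sub arclength_AC. Qed.
Let TA' : AC r0 1 T (fun r => 2 * dotv (mxv B (x r)) (v r)). Proof. exact: AC_sub TA. Qed.

Lemma defect_integrable i : integrable_on r0 1 (fun r => defect r 0 i).
Proof.
have [p' pA] := vAC_momentum r01 xA' sA' s01.
have := integrable_onD (xA' i).1 (integrable_onZ (-1) (integrable_onM (AC_continuous r01 (pA i)) sA'.1)).
by congr integrable_on; apply/funext => r; rewrite /defect !mxE; ring.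
Qed.

(** On [r0, 1] the calibration can be integrated with the arc length itself as clock. The remaining
    piece [0, r0] is handled by [calibration_le] with S = sigma r0, which bounds F at r0 by ell^2
    sigma(r0); together they leave no room for a gap. *)
Lemma defect_null : Rint r0 1 (fun r => enorm (defect r)) = 0.
Proof.
apply/eqP; rewrite eq_le; apply/andP; split; last by apply: Rintegral_ge0 => r _; exact: enorm_ge0.
have CA := calibration_AC r01 xA' sA' s01 TA'.
pose Psi r := 2 * dotv (momentum (sigma r) (x r)) (v r) - (ell^-1 * N r) *
   dotv (momentum (sigma r) (x r)) (momentum (sigma r) (x r)).
(* D >= 0 is the gap in the calibration inequality; its integral is at most 0, and
   |defect|^2 = sigma' D, so that AM-GM bounds |defect| by eta sigma' / 2 + D / (2 eta) *)
pose D r := ell * N r - Psi r.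
have Pi : integrable_on r0 1 Psi := CA.1.
have Ni' : integrable_on r0 1 N by exact: integrable_on_sub Ni.
have Di : integrable_on r0 1 D.
  have := integrable_onD (integrable_onZ ell Ni') (integrable_onZ (-1) Pi).
  by congr integrable_on; apply/funext => r; rewrite /D; ring.
have ID : Rint r0 1 D <= 0.
  have -> : Rint r0 1 D = ell * Rint r0 1 N - Rint r0 1 Psi.
    rewrite -RintZ// -mulN1r -RintZ// -RintD.
    - by apply: Rint_ext => r _; rewrite /D; ring.
    - exact: integrable_onZ.
    - exact: integrable_onZ.
  rewrite /Psi -(AC_diff CA)//.
  have -> : dotv (mxv (mxfun (ct (sigma 1)) W) (x 1)) (x 1) + T 1 = ell ^+ 2.
    rewrite -ell2 x_1 arclength1; congr (dotv (mxv _ _) _ + _).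
    by apply: (eq_mxfun Wsym) => w /Wge0 w0; rewrite hcotE.
  have xA0 : vAC 0 r0 x v by exact: vAC_sub xA.
  have TA0 : AC 0 r0 T (fun r => 2 * dotv (mxv B (x r)) (v r)) by exact: AC_sub TA.
  have s01' : 0 < sigma r0 <= 1 by apply: s01; rewrite lexx.
  have := calibration_le r00 s01' xA0 x_0 T_0 TA0.
  have E0 : Rint 0 r0 (fun r => enorm (v r)) = ell * sigma r0.
    by rewrite /sigma mulrA divff ?mul1r// lt0r_neq0.
  have E1 : Rint r0 1 N = ell - ell * sigma r0.
    by have := Rint_cat r00 r01 Ni; rewrite [Rint 0 r0 N]E0 -/ell; lra.
  rewrite E0 E1 => H.
  have : dotv (mxv (mxfun (ct (sigma r0)) W) (x r0)) (x r0) + T r0 <= ell ^+ 2 * sigma r0.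
    by rewrite -(ler_pM2l sr0); apply: le_trans H _; rewrite le_eqVlt; apply/orP; left; apply/eqP; ring.
  lra.
have dw i := defect_integrable i.
have Wi : integrable_on r0 1 (fun r => enorm (defect r)) by exact: measurable_enorm.
have key eta : 0 < eta -> Rint r0 1 (fun r => enorm (defect r)) <= eta / 2.
  move=> eta0.
  have -> : eta / 2 = eta / 2 * sigma 1 - 0 by rewrite arclength1; ring.
  have M1 : eta / 2 * Rint r0 1 (fun r => ell^-1 * N r) + (2 * eta)^-1 * Rint r0 1 D
      <= eta / 2 * sigma 1 - 0.
    have : Rint r0 1 (fun r => ell^-1 * N r) <= sigma 1.
      by rewrite -(AC_diff sA')// gerBl ltW.
    have : (2 * eta)^-1 * Rint r0 1 D <= 0.
      by rewrite mulr_ge0_le0// invr_ge0; lra.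
    have : 0 < eta / 2 by rewrite divr_gt0.
    move=> h1 h2 h3; have : eta / 2 * Rint r0 1 (fun r => ell^-1 * N r) <= eta / 2 * sigma 1.
      by rewrite ler_pM2l.
    lra.
  apply: le_trans M1.
  rewrite -(RintZ _ sA'.1) -(RintZ _ Di) -RintD; try by apply: integrable_onZ => //; exact: sA'.1.
  apply: Rint_le => //.
    by apply: integrable_onD; apply: integrable_onZ => //; exact: sA'.1.
  move=> r _.
  have sq : enorm (defect r) ^+ 2 = (ell^-1 * N r) * D r.
    rewrite enorm_sqr /defect /D /Psi; move: (momentum _ _) => p.
    rewrite !(dotvDl, dotvDr, dotvNl, dotvNr, dotvZl, dotvZr).
    rewrite (dotvC (v r) p) -(enorm_sqr (v r)) -/(N r).
    by field; rewrite lt0r_neq0.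
  have w0 := enorm_ge0 (defect r).
  have s0 : 0 <= ell^-1 * N r by rewrite mulr_ge0// invr_ge0 ltW.
  (* The AM-GM step divides by sigma'; where sigma' = 0, the velocity vanishes and D with it. *)
  have D0 : ell^-1 * N r = 0 -> D r = 0.
    move=> /eqP; rewrite mulf_eq0 invr_eq0 gt_eqF /= => [/eqP Nr|//].
    have vr : v r = 0 by apply: dotv_eq0; rewrite -enorm_sqr -/(N r) Nr expr0n.
    by rewrite /D /Psi Nr vr dotv0; ring.
  move: sq s0 w0 D0; move: (enorm _) (ell^-1 * N r) (D r) => e s d sq s0 e0 D0.
  have [s_0|sn0] := eqVneq s 0.
    rewrite D0// s_0 !mulr0 addr0 -(@ler_pXn2r _ 2) ?nnegrE// sq s_0 mul0r.
    by rewrite expr0n.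
  have d0 : d = e ^+ 2 / s by rewrite sq; field.
  have sp : 0 < s by rewrite lt_def sn0.
  have : 0 <= (eta * s - e) ^+ 2 / (2 * eta * s).
    by rewrite mulr_ge0 ?sqr_ge0// invr_ge0 mulr_ge0//; lra.
  rewrite d0; have -> : (eta * s - e) ^+ 2 / (2 * eta * s) = eta / 2 * s + (2 * eta)^-1 * (e ^+ 2 / s) - e.
    by field; rewrite sn0 lt0r_neq0.
  lra.
apply/ler_addgt0Pr => e e0; rewrite add0r.
have := key (2 * e); have -> : 2 * e / 2 = e by field.
by apply; rewrite mulr_gt0.
Qed.

Lemma minimizer_eq_traj : x r0 = traj (sigma r0).
Proof.
have trA := vAC_comp r01 vder_traj vder_vel sA'.
have eA := vACB xA' trA.
have yA := vAC_mxfun Wsym r01 (fun w we => AC_snV r01 sA' s01 we) eA.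
set y := (fun r => mxv (mxfun (fun w => (sn (sigma r) w)^-1) W) (x r - traj (sigma r))) in yA.
(* The derivative - ct / sn of 1 / sn cancels the [ct] part of the momentum. Besides the defect
   there remains sigma' B y, which is orthogonal to y. *)
have yE r : r0 <= r <= 1 ->
  mxv (mxfun (fun w => - ct (sigma r) w / sn (sigma r) w * (ell^-1 * N r)) W) (x r - traj (sigma r)) +
  mxv (mxfun (fun w => (sn (sigma r) w)^-1) W) (v r - (ell^-1 * N r) *: vel (sigma r))
  = mxv (mxfun (fun w => (sn (sigma r) w)^-1) W) (defect r) + (ell^-1 * N r) *: mxv B (y r).
  move=> rr; have s01r := s01 rr.
  set k := ell^-1 * N r; set S := mxfun (fun w => (sn (sigma r) w)^-1) W.
  have -> : v r - k *: vel (sigma r) = defect r + k *: momentum (sigma r) (x r - traj (sigma r)).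
    by rewrite vel_momentum// /defect -/k momentumB scalerBr addrA subrK.
  rewrite mxfunZr mxvZl [mxv S (defect r + _)]mxvDr [mxv S (k *: _)]mxvZr /momentum [mxv S (_ + _)]mxvDr -[mxv S (mxv (mxfun _ _) _)]mxvM (mxfunM Wsym).
  have -> : mxv (mxfun (fun w => (sn (sigma r) w)^-1 * ct (sigma r) w) W) (x r - traj (sigma r)) =
      - mxv (mxfun (fun w => - ct (sigma r) w / sn (sigma r) w) W) (x r - traj (sigma r)).
    by rewrite -mxvNl (mxfunN Wsym); congr (mxv (mxfun _ _) _); apply/funext => w; ring.
  have -> : mxv S (mxv B (x r - traj (sigma r))) = mxv B (y r).
    by rewrite -mxvM -(skew_mxfun_comm Bskew) mxvM.
  by rewrite scalerDr scalerN addrCA addNKr.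
have KA := vAC_mxfun Wsym r01 (fun w we => AC_snV r01 sA' s01 we) yA.
have [Ki K0] := Rint_dotv_null r01 KA defect_integrable defect_null.
have := AC_diff (AC_dotv r01 yA yA) (lexx r0) r01 (lexx 1).
rewrite (@Rint_ext _ _ _ _ (fun r => 2 * dotv (mxv (mxfun (fun w => (sn (sigma r) w)^-1) W) (y r)) (defect r))); last first.
  move=> r rr; rewrite yE// dotvDl dotvDr dotvZl dotvZr (dotvC (y r) (mxv B _)) (skew_dotv0 _ Bskew) mulr0 !addr0.
  by rewrite [in RHS]dotv_mxv (mxfun_trmx Wsym) dotvC; ring.
rewrite RintZ// K0 mulr0.
(* Both curves end at x0. The start could not be used here, since 1 / sn is singular at clock value
   0. *)
have -> : y 1 = 0 by rewrite /y arclength1 x_1 traj1 subrr mxv0.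
rewrite dot0v sub0r => /eqP; rewrite oppr_eq0 => /eqP /dotv_eq0 y0.
have : mxv (mxfun (sn (sigma r0)) W) (y r0) = 0 by rewrite y0 mxv0.
rewrite /y -mxvM (mxfunM Wsym) (eq_mxfun Wsym (k := fun=> 1)); last first.
  by move=> w we; rewrite divff// sn_neq0// s01// lexx.
by rewrite (mxfun1 Wsym) mxv1 => /eqP; rewrite subr_eq0 => /eqP.
Qed.

End PositiveArclength.

Lemma integrable_dotv m a b (k k' w : R -> 'rV[R]_m) : a <= b -> vAC a b k k' ->
  (forall i, integrable_on a b (fun r => w r 0 i)) ->
  integrable_on a b (fun r => dotv (k r) (w r)).
Proof.
move=> ab kA wi; apply: integrable_on_sum => i.
exact: integrable_onM (AC_continuous ab (kA i)) (wi i).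
Qed.

Lemma vAC_traj a b : a <= b -> vAC a b traj vel.
Proof. by move=> ab; exact: vAC_vder vder_traj vder_vel. Qed.

Lemma vAC_vel a b : a <= b -> vAC a b vel (fun s => 2 *: mxv B (vel s)).
Proof. by move=> ab; apply: (vAC_vder ab vder_vel); exact: vderZ (vder_mxv B vder_vel). Qed.

Lemma integrable_traj_form (A : 'M[R]_n) a b :
  integrable_on a b (fun s => dotv (mxv A (traj s)) (vel s)).
Proof.
have [ab|ba] := leP a b.
  by apply: (integrable_dotv ab (vAC_mxv A (vAC_traj ab))) => i; exact: (vAC_traj ab i).1.
by rewrite /integrable_on set_itv_ge ?integrable_set0// bnd_simp -ltNge.
Qed.

(** The base point -1 and the range (-1, 2) put the clock values 0 and 1 in the interior, where the
    indefinite integral has a two-sided derivative. *)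
Lemma AC_traj_form_comp (A : 'M[R]_n) a b (f f' : R -> R) : a <= b -> AC a b f f' ->
  (forall r, a <= r <= b -> 0 <= f r <= 1) ->
  AC a b (fun r => Rint (-1) (f r) (fun s => dotv (mxv A (traj s)) (vel s)))
         (fun r => dotv (mxv A (traj (f r))) (vel (f r)) * f' r).
Proof.
move=> ab fA f01.
set k := fun s => dotv (mxv A (traj s)) (vel s).
have kc (y : R) : {for y, continuous k}.
  have : k = \sum_i (fun s => mxv A (traj s) 0 i) * (fun s => vel s 0 i).
    by apply/funext => s; rewrite fct_sumE.
  move=> ->.
  have D := is_derive_sum (fun i => is_deriveM (vder_mxv A vder_traj i y) (vder_vel i y)).
  exact: is_derive_continuous D.
apply: (AC_comp (P := fun y => -1 < y < 2) (h := fun y => Rint (-1) y k) (h' := k)) => //.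
- by move=> y z w /andP[? _] /andP[_ ?] /andP[? ?]; apply/andP; split; lra.
- by move=> r /f01 /andP[? ?]; apply/andP; split; lra.
- move=> y /andP[y1 y2].
  have ki : integrable_on (-1) 2 k by exact: integrable_traj_form.
  have [d1 d2] := continuous_FTC1_closed y2 ki y1 (kc y).
  by apply: DeriveDef; [exact: d1|rewrite -derive1E; exact: d2].
Qed.

(** Change of variables s = sigma(r) in the integrals that give the t component. Replacing v by
    sigma' vel(sigma) costs the integral of <A x, defect>, which is zero. *)
Lemma minimizer_form (A : 'M[R]_n) r0 : 0 <= r0 -> r0 <= 1 -> 0 < sigma r0 ->
  Rint r0 1 (fun r => dotv (mxv A (x r)) (v r)) =
  Rint (sigma r0) 1 (fun s => dotv (mxv A (traj s)) (vel s)).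
Proof.
move=> r00 r01 sr0.
have s_pos r : r0 <= r <= 1 -> 0 < sigma r.
  by move=> /andP[r0r r1]; apply: lt_le_trans sr0 _; exact: arclength_mono.
have s_le1 r : 0 <= r <= 1 -> sigma r <= 1.
  by move=> /andP[r0' r1]; rewrite -[leRHS]arclength1; exact: arclength_mono.
have xeq r : r0 <= r <= 1 -> x r = traj (sigma r).
  move=> rr; have /andP[r0r r1] := rr.
  by apply: minimizer_eq_traj => //; [exact: le_trans r00 r0r|exact: s_pos].
have xA1 : vAC r0 1 x v by exact: vAC_sub xA.
have sA1 : AC r0 1 sigma (fun r => ell^-1 * N r) by exact: AC_sub arclength_AC.
have sr1 r : r0 <= r <= 1 -> 0 <= sigma r <= 1.
  move=> rr; have /andP[r0r r1] := rr; rewrite ltW ?s_pos//= s_le1//.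
  by rewrite (le_trans r00 r0r).
have KA := AC_traj_form_comp A r01 sA1 sr1.
have fi : integrable_on r0 1 (fun r => dotv (mxv A (x r)) (v r)).
  by apply: (integrable_dotv r01 (vAC_mxv A xA1)) => i; exact: (xA1 i).1.
have [_ d0] := Rint_dotv_null r01 (vAC_mxv A xA1)
  (defect_integrable r00 r01 sr0) (defect_null r00 r01 sr0).
have Ki := KA.1.
have : Rint r0 1 (fun r => dotv (mxv A (x r)) (v r)) =
   Rint r0 1 (fun r => dotv (mxv A (traj (sigma r))) (vel (sigma r)) * (ell^-1 * N r)).
  apply/eqP; rewrite -subr_eq0 -mulN1r -RintZ// -RintD//; last exact: integrable_onZ.
  rewrite -[X in _ == X]d0; apply/eqP/Rint_ext => r rr.
  have vm : vel (sigma r) = momentum (sigma r) (x r).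
    by rewrite (xeq r rr) vel_momentum// s_pos//=; have /andP[] := sr1 r rr.
  rewrite /defect vm -(xeq r rr) dotvDr dotvNr dotvZr; ring.
move=> ->; rewrite -(AC_diff KA)// arclength1.
have s1 : sigma r0 <= 1 by apply: s_le1; rewrite r00.
rewrite (@Rint_cat _ (-1) 1 (sigma r0))//; last exact: integrable_traj_form.
  by rewrite addrAC subrr add0r.
by apply: le_trans (ltW sr0); rewrite lerN10.
Qed.

(** A minimizer may rest at the origin on an initial interval, where sigma = 0 and the rigidity
    argument does not apply. *)
Lemma minimizer_start r : 0 <= r -> r <= 1 -> sigma r = 0 ->
  x r = 0 /\ forall A : 'M[R]_n, Rint 0 r (fun r => dotv (mxv A (x r)) (v r)) = 0.
Proof.
move=> r0 r1 sr.
have xA0 : vAC 0 r x v by exact: vAC_sub xA.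
have Nr : Rint 0 r (fun r => enorm (v r)) = 0.
  by move: sr => /eqP; rewrite mulf_eq0 invr_eq0 gt_eqF//= => /eqP.
have vi i : integrable_on 0 r (fun r => v r 0 i) by exact: (xA0 i).1.
split.
  apply/rowP => i; rewrite mxE ((xA0 i).2 r) ?r0 ?lexx// x_0 mxE add0r.
  apply/eqP; rewrite -normr_le0; apply: le_trans (Rint_norm (vi i)) _.
  rewrite -[leRHS]Nr; apply: Rint_le => [||s _]; last exact: abs_coord_le_enorm.
    exact: integrable_on_norm.
  exact: measurable_enorm.
by move=> A; have [] := Rint_dotv_null r0 (vAC_mxv A xA0) vi Nr.
Qed.

(** [minimizer_form] gives the integrals over the tails [r, 1], and those over [0, r] follow by
    subtraction from the total. The totals will agree because both curves end at the same t0. *)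
Lemma minimizer_reparam r : 0 <= r <= 1 ->
  x r = traj (sigma r) /\ forall A : 'M[R]_n,
    Rint 0 1 (fun r => dotv (mxv A (x r)) (v r)) =
      Rint 0 1 (fun s => dotv (mxv A (traj s)) (vel s)) ->
    Rint 0 r (fun r => dotv (mxv A (x r)) (v r)) =
      Rint 0 (sigma r) (fun s => dotv (mxv A (traj s)) (vel s)).
Proof.
move=> /andP[r0 r1].
have s0 : 0 <= sigma r by rewrite -arclength0 arclength_mono.
have s1 : sigma r <= 1 by rewrite -[leRHS]arclength1; exact: arclength_mono.
have [s_0|s_n0] := eqVneq (sigma r) 0.
  by have [-> fr] := minimizer_start r0 r1 s_0; rewrite s_0 traj0; split=> // A _; rewrite fr Rint_id.
have sr : 0 < sigma r by rewrite lt_def s_n0.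
split; first exact: minimizer_eq_traj.
move=> A; rewrite (Rint_cat r0 r1); last first.
  by apply: (integrable_dotv ler01 (vAC_mxv A xA)) => i; exact: (xA i).1.
rewrite (Rint_cat s0 s1 (integrable_traj_form A 0 1)) (minimizer_form A r0 r1 sr).
exact: addIr.
Qed.

End EqualityCase.

End SkewTrajectories.

#[global] Opaque traj vel.

(** * Variation of the skew-symmetric matrix *)

Section Variation.
Variables (R : realType) (n : nat).

Lemma skewB (A B : 'M[R]_n) : A^T = - A -> B^T = - B -> (A - B)^T = - (A - B).
Proof. by move=> As Bs; rewrite linearB /= As Bs opprB opprK addrC. Qed.

(* This is [calibration_le] for the loop d, followed by |length|^2 <= energy. *)
Lemma loop_inequality B (d d' d'' : R -> 'rV[R]_n) : B^T = - B ->
  (forall w, eigen (- (B *m B)) w -> w < pi ^+ 2) ->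
  vAC 0 1 d d' -> vAC 0 1 d' d'' -> d 0 = 0 -> d 1 = 0 ->
  Rint 0 1 (fun s => 2 * dotv (mxv B (d s)) (d' s)) <= Rint 0 1 (fun s => dotv (d' s) (d' s)).
Proof.
move=> Bs Blt dA d'A d0 d1.
have d'i i : integrable_on 0 1 (fun r => d' r 0 i) by exact: (dA i).1.
have Fi : integrable_on 0 1 (fun s => 2 * dotv (mxv B (d s)) (d' s)).
  by apply: integrable_onZ; exact: integrable_dotv (vAC_mxv B dA) d'i.
have Ei : integrable_on 0 1 (fun s => dotv (d' s) (d' s)) by exact: integrable_dotv d'A d'i.
have Ni : integrable_on 0 1 (fun s => enorm (d' s)) by exact: measurable_enorm.
have TA := AC_int 0 Fi.
have T0 : 0 + Rint 0 0 (fun s => 2 * dotv (mxv B (d s)) (d' s)) = 0 by rewrite Rint_id addr0.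
have S01 : ((0 : R) < 1) && ((1 : R) <= 1) by rewrite ltr01 lexx.
have := calibration_le Bs Blt ler01 S01 dA d0 T0 TA.
rewrite d1 mxv0 dot0v mul1r !add0r => /le_trans; apply.
set ell := Rint 0 1 (fun r => enorm (d' r)).
have : Rint 0 1 (fun s => 2 * ell * enorm (d' s)) <= Rint 0 1 (fun s => ell ^+ 2 + dotv (d' s) (d' s)).
  apply: Rint_le.
  - exact: integrable_onZ.
  - by apply: integrable_onD => //; exact: integrable_on_cst.
  - move=> s _; rewrite -enorm_sqr; have := sqr_ge0 (ell - enorm (d' s)); lra.
rewrite RintZ// RintD//; last exact: integrable_on_cst.
rewrite Rint_cst// -/ell; lra.
Qed.

Section TwoMatrices.
Variables (B0 B1 : 'M[R]_n) (x1 : 'rV[R]_n) (y eta x zeta : R -> 'rV[R]_n).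
Hypotheses (B0s : B0^T = - B0) (B1s : B1^T = - B1).
Hypotheses (yA : vAC 0 1 y eta) (etaA : vAC 0 1 eta (fun s => 2 *: mxv B0 (eta s))).
Hypotheses (xA : vAC 0 1 x zeta) (zetaA : vAC 0 1 zeta (fun s => 2 *: mxv B1 (zeta s))).
Hypotheses (y_0 : y 0 = 0) (y_1 : y 1 = x1) (x_0 : x 0 = 0) (x_1 : x 1 = x1).
Local Notation D := (B1 - B0).

(** Boundary term of <zeta - B1 x, y> - <x, eta - B0 y> - <x, D y>, which pairs the costate of each
    trajectory with the position of the other. The identity is exact, with no smallness of D. *)
Lemma ucot_variation : dotv (zeta 1) x1 - dotv (eta 1) x1 =
  - 2 * Rint 0 1 (fun s => dotv (mxv D (y s)) (zeta s)).
Proof.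
have pA := vACB zetaA (vAC_mxv B1 xA).
have rA := vACB etaA (vAC_mxv B0 yA).
have GA := ACB (ACB (AC_dotv ler01 pA yA) (AC_dotv ler01 xA rA)) (AC_dotv ler01 xA (vAC_mxv D yA)).
have := AC_diff GA (lexx 0) ler01 (lexx 1).
rewrite x_0 x_1 y_0 y_1 !(mxv0, dot0v, dotv0) !(subr0, subrr).
have -> : dotv x1 (mxv D x1) = 0 by rewrite dotvC (skew_dotv0 _ (skewB B1s B0s)).
rewrite subr0 dotvDl dotvDr dotvNl dotvNr (skew_dotv0 _ B1s) (dotvC x1 (mxv B0 x1)) (skew_dotv0 _ B0s).
rewrite !subr0 (dotvC x1) => ->.
rewrite -RintZ; last by apply: (integrable_dotv ler01 (vAC_mxv D yA)) => i; exact: (xA i).1.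
apply: Rint_ext => s _.
rewrite !mxvBl !(dotvDl, dotvDr, dotvNl, dotvNr, dotvZl, dotvZr).
rewrite !(skew_dotv _ _ B1s) !(skew_dotv _ _ B0s).
rewrite (dotvC (zeta s) (mxv B1 (y s))) (dotvC (zeta s) (mxv B0 (y s))).
rewrite !(skew_dotv _ _ B1s) !(skew_dotv _ _ B0s).
have E1 : dotv (zeta s) (mxv B1 (y s)) = - dotv (y s) (mxv B1 (zeta s)).
  by rewrite dotvC (skew_dotv _ _ B1s).
lra.
Qed.

(** With d = x - y, one has d'' = 2 B1 d' + 2 D eta; the identity integrates the derivative of <d' -
    B1 d, d> + 2 <y, D d>, which vanishes at both ends. *)
Lemma energy_variation :
  Rint 0 1 (fun s => dotv (zeta s - eta s) (zeta s - eta s)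
                     - 2 * dotv (mxv B1 (x s - y s)) (zeta s - eta s))
  = 2 * Rint 0 1 (fun s => dotv (mxv D (y s)) (zeta s - eta s)).
Proof.
have dA := vACB xA yA.
have d'A := vACB zetaA etaA.
have d'i i : integrable_on 0 1 (fun r => (zeta r - eta r) 0 i) by exact: (dA i).1.
have HA := ACD (AC_dotv ler01 (vACB d'A (vAC_mxv B1 dA)) dA) (ACZ 2 (AC_dotv ler01 yA (vAC_mxv D dA))).
have := AC_diff HA (lexx 0) ler01 (lexx 1).
rewrite x_0 x_1 y_0 y_1 !subrr !(mxv0, dotv0) mulr0 addr0 subrr => H0.
have I1 := integrable_dotv ler01 d'A d'i.
have I2 := integrable_dotv ler01 (vAC_mxv B1 dA) d'i.
have I3 := integrable_dotv ler01 (vAC_mxv D yA) d'i.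
apply/eqP; rewrite -subr_eq0 -mulNr -RintZ// -RintD; last exact: integrable_onZ.
- apply/eqP; rewrite [RHS]H0; apply: Rint_ext => s _.
  set d' := zeta s - eta s; set d := x s - y s.
  have -> : 2 *: mxv B1 (zeta s) - 2 *: mxv B0 (eta s) = 2 *: mxv B1 d' + 2 *: mxv D (eta s).
    by rewrite /d' mxvBr mxvBl !scalerBr addrA subrK.
  rewrite !(dotvDl, dotvNl, dotvZl).
  have Ds := skewB B1s B0s.
  rewrite (skew_dotv (y s) d' Ds) (skew_dotv d' d B1s) (skew_dotv (eta s) d Ds).
  rewrite (dotvC d' (mxv B1 d)); ring.
- have := integrable_onD I1 (integrable_onZ (-2) I2).
  by congr integrable_on; apply/funext => s; ring.
Qed.

End TwoMatrices.

(* With d the difference of the trajectories of B + e V and B, the energy of d is O(e J) for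
   J = int <V y, d'>, hence J = O(e): the first variation at B is obtained without
   differentiating the functional calculus in B. *)
Lemma endpoint_inequality (B V : 'M[R]_n) (x0 : 'rV[R]_n) (h lam e0 : R) : B^T = - B -> V^T = - V ->
  1 < lam -> 0 < e0 ->
  (forall w, eigen (- (B *m B)) w -> w < pi ^+ 2) ->
  (forall e, 0 < e < e0 -> forall w, eigen (- ((B + e *: V) *m (B + e *: V))) w -> w < pi ^+ 2) ->
  (forall e, 0 < e < e0 -> forall w,
     eigen (- ((lam *: (B + e *: V)) *m (lam *: (B + e *: V)))) w -> w < pi ^+ 2) ->
  (forall e, 0 < e < e0 ->
     dotv (vel (B + e *: V) x0 1) x0 + 4 * e * h <= dotv (vel B x0 1) x0) ->
  2 * h <= Rint 0 1 (fun s => dotv (mxv V (traj B x0 s)) (vel B x0 s)).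
Proof.
move=> Bs Vs lam1 e00 Blt Belt lBelt maxh.
have yA := vAC_traj Bs Blt x0 ler01; have etaA := vAC_vel Bs Blt x0 ler01.
have VyA := vAC_mxv V yA.
pose M := Rint 0 1 (fun s => dotv (mxv V (traj B x0 s)) (mxv V (traj B x0 s))).
have Vyi i : integrable_on 0 1 (fun s => mxv V (traj B x0 s) 0 i).
  by apply: continuous_compact_integrable; [exact: segment_compact|exact: AC_continuous (VyA i)].
have Mi := integrable_dotv ler01 VyA Vyi.
have M0 : 0 <= M by apply: Rintegral_ge0 => s _; exact: dotv_ge0.
(* Coercivity constant: the loop inequality for lam B1, rather than B1, leaves the fraction 1 - 1 /
   lam of the energy of d. *)
pose c := 1 - lam^-1.
have lam0 : 0 < lam by lra.
have c0 : 0 < c by rewrite subr_gt0 invf_lt1.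
set base := Rint 0 1 _.
suff key e : 0 < e < e0 -> 2 * h <= base + 2 * M / c * e.
  apply/ler_addgt0Pr => r r0.
  pose e := Num.min (e0 / 2) (r / (2 * M / c + 1)).
  have K0 : 0 <= 2 * M / c by rewrite divr_ge0 ?mulr_ge0// ltW.
  have e_0 : 0 < e by rewrite lt_min !divr_gt0//; lra.
  have e_e0 : e < e0 by rewrite gt_min; apply/orP; left; lra.
  apply: le_trans (key e _) _; first by rewrite e_0.
  rewrite lerD2l; apply: (@le_trans _ _ (2 * M / c * (r / (2 * M / c + 1)))).
    by rewrite ler_wpM2l// ge_min lexx orbT.
  move: (2 * M / c) K0 => K K0; rewrite mulrA ler_pdivrMr; lra.
move=> ee; have /andP[e_0 _] := ee.
set B1 := B + e *: V.
have B1s : B1^T = - B1 by rewrite /B1 linearD linearZ /= Bs Vs scalerN opprD.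
have B1lt := Belt e ee; have lB1lt := lBelt e ee.
have lB1s : (lam *: B1)^T = - (lam *: B1) by rewrite linearZ /= B1s scalerN.
have DE : B1 - B = e *: V by rewrite /B1 addrC addKr.
have xA := vAC_traj B1s B1lt x0 ler01; have zetaA := vAC_vel B1s B1lt x0 ler01.
have := maxh e ee; rewrite -/B1 => max1.
have y0 := traj0 Bs x0; have y1 := traj1 Bs Blt x0.
have x0' := traj0 B1s x0; have x1 := traj1 B1s B1lt x0.
have V1 := ucot_variation Bs B1s yA etaA xA zetaA y0 y1 x0' x1.
have V2 := energy_variation Bs B1s yA etaA xA zetaA y0 y1 x0' x1.
have dA := vACB xA yA; have d'A := vACB zetaA etaA.
have dd0 : traj B1 x0 0 - traj B x0 0 = 0 by rewrite x0' y0 subrr.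
have dd1 : traj B1 x0 1 - traj B x0 1 = 0 by rewrite x1 y1 subrr.
have V3 := loop_inequality lB1s lB1lt dA d'A dd0 dd1.
move: V1 V2 V3; rewrite DE.
move=> V1 V2 V3.
have d'i i : integrable_on 0 1 (fun r => (vel B1 x0 r - vel B x0 r) 0 i) by exact: (dA i).1.
pose J := Rint 0 1 (fun s => dotv (mxv V (traj B x0 s)) (vel B1 x0 s - vel B x0 s)).
pose E := Rint 0 1 (fun s => dotv (vel B1 x0 s - vel B x0 s) (vel B1 x0 s - vel B x0 s)).
pose Q := Rint 0 1 (fun s => dotv (mxv B1 (traj B1 x0 s - traj B x0 s)) (vel B1 x0 s - vel B x0 s)).
have Ji := integrable_dotv ler01 VyA d'i.
have Ei := integrable_dotv ler01 d'A d'i.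
have Qi := integrable_dotv ler01 (vAC_mxv B1 dA) d'i.
have Vzi : integrable_on 0 1 (fun s => dotv (mxv V (traj B x0 s)) (vel B1 x0 s)).
  by apply: (integrable_dotv ler01 VyA) => i; exact: (xA i).1.
have Vei : integrable_on 0 1 (fun s => dotv (mxv V (traj B x0 s)) (vel B x0 s)).
  by apply: (integrable_dotv ler01 VyA) => i; exact: (yA i).1.
have W1 : Rint 0 1 (fun s => dotv (mxv V (traj B x0 s)) (vel B1 x0 s)) = base + J.
  rewrite /base /J -RintD//; apply: Rint_ext => s _; by rewrite dotvDr dotvNr; ring.
have W2 : E - 2 * Q = 2 * e * J.
  rewrite -mulNr -RintZ// -RintD//; last exact: integrable_onZ.
  rewrite -mulrA -[e * J]RintZ//.
  transitivity (2 * Rint 0 1 (fun s => dotv (mxv (e *: V) (traj B x0 s)) (vel B1 x0 s - vel B x0 s))).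
    by rewrite -V2; apply: Rint_ext => s _; ring.
  by congr (_ * _); apply: Rint_ext => s _; rewrite mxvZl dotvZl.
have W3 : 2 * lam * Q <= E.
  rewrite -RintZ//; apply: le_trans V3; rewrite le_eqVlt; apply/orP; left; apply/eqP.
  by apply: Rint_ext => s _; rewrite mxvZl dotvZl; ring.
have W4 : c * E <= 2 * e * J.
  have : lam^-1 * (2 * lam * Q) <= lam^-1 * E by rewrite ler_pM2l// invr_gt0.
  have -> : lam^-1 * (2 * lam * Q) = 2 * Q by field; rewrite lt0r_neq0.
  rewrite -W2 /c; lra.
(* Young's inequality, weighted so that by W4 the energy term is at most J / 2 and can be
   absorbed. *)
have W5 : J <= c / (2 * e) / 2 * E + e / c * M.
  have ce : 0 < c / (2 * e) by rewrite divr_gt0// mulr_gt0.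
  have -> : c / (2 * e) / 2 * E + e / c * M = Rint 0 1 (fun s =>
     c / (2 * e) / 2 * dotv (vel B1 x0 s - vel B x0 s) (vel B1 x0 s - vel B x0 s) + e / c * dotv (mxv V (traj B x0 s)) (mxv V (traj B x0 s))).
    by rewrite RintD ?RintZ//; exact: integrable_onZ.
  apply: Rint_le => //; first by apply: integrable_onD; exact: integrable_onZ.
  move=> s _; have := dotv_ge0 (c *: (vel B1 x0 s - vel B x0 s) - (2 * e) *: mxv V (traj B x0 s)).
  move: (vel B1 x0 s - vel B x0 s) (mxv V (traj B x0 s)) => a b.
  rewrite !(dotvDl, dotvDr, dotvNl, dotvNr, dotvZl, dotvZr) (dotvC a b) => H.
  have : 0 <= (c * (c * dotv a a) - 2 * e * (c * dotv b a) +
      (- (c * (2 * e * dotv b a)) - - (2 * e * (2 * e * dotv b b)))) / (4 * c * e).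
    by apply: divr_ge0; [lra|rewrite ltW// !mulr_gt0].
  have -> : (c * (c * dotv a a) - 2 * e * (c * dotv b a) +
      (- (c * (2 * e * dotv b a)) - - (2 * e * (2 * e * dotv b b)))) / (4 * c * e) =
      c / (2 * e) / 2 * dotv a a + e / c * dotv b b - dotv b a.
    by field; rewrite !lt0r_neq0.
  lra.
have W6 : J <= 2 * M / c * e.
  have : c / (2 * e) / 2 * E <= J / 2.
    have -> : c / (2 * e) / 2 * E = (4 * e)^-1 * (c * E) by field; rewrite lt0r_neq0.
    have -> : J / 2 = (4 * e)^-1 * (2 * e * J) by field; rewrite lt0r_neq0.
    by rewrite ler_pM2l// invr_gt0 mulr_gt0.
  have -> : 2 * M / c * e = 2 * (e / c * M) by field; rewrite lt0r_neq0.
  lra.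
have W7 : Rint 0 1 (fun s => dotv (mxv (e *: V) (traj B x0 s)) (vel B1 x0 s)) = e * (base + J).
  by rewrite -W1 -RintZ//; apply: Rint_ext => s _; rewrite mxvZl dotvZl.
have : 4 * e * h <= 2 * e * (base + J) by rewrite W7 in V1; lra.
have -> : 4 * e * h = 2 * e * (2 * h) by ring.
rewrite ler_pM2l ?mulr_gt0//; lra.
Qed.

End Variation.

(** * Horizontal curves *)

Section Subriemannian.
Variables (R : realType) (q m : nat) (U : 'I_m -> 'M[R]_q).
Hypothesis Uskew : skew_family U.
Implicit Types (u tau : 'rV[R]_m).

Lemma Ut_skew tau : (Ut U tau)^T = - Ut U tau.
Proof.
rewrite /Ut raddf_sum -sumrN; apply: eq_bigr => j _ /=.
by rewrite linearZ /= Uskew scalerN.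
Qed.

Lemma UtD tau u : Ut U (tau + u) = Ut U tau + Ut U u.
Proof. by rewrite /Ut -big_split; apply: eq_bigr => j _; rewrite mxE scalerDl. Qed.

Lemma UtZ k tau : Ut U (k *: tau) = k *: Ut U tau.
Proof. by rewrite /Ut scaler_sumr; apply: eq_bigr => j _; rewrite mxE scalerA. Qed.

Lemma dotv_Uform x v u : dotv (Uform U x v) u = dotv (mxv (Ut U u) x) v.
Proof.
rewrite /Ut mxv_suml dotvC [RHS]dotvC dotv_sumr; apply: eq_bigr => j _.
by rewrite mxvZl dotvZr mxE (dotvC v).
Qed.

Lemma opnorm_ubound (A : 'M[R]_q) x : enorm x <= 1 -> enorm (mxv A x) <= opnorm A.
Proof.
move=> x1; apply: ub_le_sup; last by exists x.
have [K K0 HK] := mxv_bounded A; exists K => _ [z /= z1 <-].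
by apply: le_trans (HK z) _; rewrite -[leRHS]mulr1 ler_wpM2l.
Qed.

Lemma opnorm_le (A : 'M[R]_q) b : (forall x, enorm x <= 1 -> enorm (mxv A x) <= b) -> opnorm A <= b.
Proof.
move=> H; apply: ge_sup; last by move=> _ [x /= x1 <-]; exact: H.
by exists (enorm (mxv A 0)), 0 => //=; rewrite enorm0.
Qed.

Lemma opnorm_ge0 (A : 'M[R]_q) : 0 <= opnorm A.
Proof. by apply: le_trans (enorm_ge0 (mxv A 0)) (opnorm_ubound _ _); rewrite enorm0. Qed.

Lemma Omega_star_eigen tau w : Omega_star U tau ->
  eigen (- (Ut U tau *m Ut U tau)) w -> w < pi ^+ 2.
Proof.
move=> /= Otau [v v0 vw]; set B := Ut U tau in Otau vw *.
have nv : 0 < enorm v.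
  rewrite lt_def enorm_ge0 andbT; apply: contra_neq v0 => E.
  by apply: dotv_eq0; rewrite -enorm_sqr E expr0n.
pose x := (enorm v)^-1 *: v.
have x1 : enorm x = 1 by rewrite enormZ ger0_norm ?invr_ge0 ?enorm_ge0// mulVf// lt0r_neq0.
have := opnorm_ubound B (x := x); rewrite x1 lexx => /(_ isT) Bx.
have Ew : enorm (mxv B x) ^+ 2 = w.
  rewrite enorm_sqr -(skew_sq_dotv (Ut_skew tau)) /x mxvZr vw scalerA mulrC -scalerA dotvZl.
  by rewrite -/x -enorm_sqr x1 expr1n mulr1.
rewrite -Ew; have := enorm_ge0 (mxv B x); have := pi_gt0 R => p0 e0.
by rewrite ltr_pXn2r ?nnegrE ?(ltW p0)//; exact: le_lt_trans Bx Otau.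
Qed.

(** The dilation by [lam] is the margin from which [endpoint_inequality] draws its coercivity. *)
Lemma Omega_star_open_along tau u : Omega_star U tau -> exists lam e0 : R,
  [/\ 1 < lam, 0 < e0,
     (forall e, 0 < e < e0 -> Omega_star U (tau + e *: u)) &
     (forall e, 0 < e < e0 -> Omega_star U (lam *: (tau + e *: u)))].
Proof.
rewrite /Omega_star /=; set M := opnorm (Ut U tau) => Mpi.
have M0 : 0 <= M := opnorm_ge0 _.
have [K K0 HK] := mxv_bounded (Ut U u).
(* [lam] sends the midpoint of M and pi to pi, and [e0] keeps the perturbed norm below that
   midpoint. *)
pose lam := 2 * pi / (M + pi) : R; pose e0 := (pi - M) / (2 * (K + 1)).
have Mp : 0 < M + pi by lra.
have lam1 : 1 < lam by rewrite ltr_pdivlMr//; lra.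
have e00 : 0 < e0 by rewrite divr_gt0//; lra.
have bound e x : 0 < e < e0 -> enorm x <= 1 ->
    enorm (mxv (Ut U (tau + e *: u)) x) <= M + e * K.
  move=> /andP[e_0 _] x1; rewrite UtD UtZ mxvDl mxvZl.
  apply: le_trans (enormD _ _) _; apply: lerD; first exact: opnorm_ubound.
  rewrite enormZ ger0_norm ?(ltW e_0)// ler_pM2l//.
  by apply: le_trans (HK x) _; rewrite -[leRHS]mulr1 ler_wpM2l.
have small e : 0 < e < e0 -> M + e * K < (M + pi) / 2.
  move=> /andP[e_0 ee0].
  have : e * (2 * (K + 1)) < pi - M by rewrite -ltr_pdivlMr//; lra.
  nra.
exists lam, e0; split=> // e ee; have S := small e ee.
  by apply: le_lt_trans (opnorm_le (fun x => bound e x ee)) _; lra.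
apply: (@le_lt_trans _ _ (lam * (M + e * K))).
  apply: opnorm_le => x x1; rewrite UtZ mxvZl enormZ ger0_norm; last lra.
  rewrite ler_pM2l; last lra.
  exact: bound.
have -> : pi = lam * ((M + pi) / 2) :> R by rewrite /lam; field; lra.
by rewrite ltr_pM2l; lra.
Qed.

Lemma phi_vel x0 t0 tau : Omega_star U tau ->
  phi U (x0, t0) tau = dotv (vel (Ut U tau) x0 1) x0 + 4 * dotv t0 tau.
Proof.
move=> Ot; rewrite /phi /=; congr (_ + _).
by apply: (ucot_vel1 (Ut_skew tau)) => w; exact: Omega_star_eigen.
Qed.

Section Horizontal.
Variables (c : curve R q m) (v : R -> 'rV[R]_q).
Hypotheses (hor : horizontal U c v) (c0 : c 0 = origin R q m).

Lemma horizontal_vAC : vAC 0 1 (fun s => (c s).1) v.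
Proof.
move=> i; split; first exact: hor.1 i.
by move=> s s01; have [-> _] := hor.2 s s01; rewrite !mxE.
Qed.

Lemma integrable_Uform (A : 'M[R]_q) b : b <= 1 ->
  integrable_on 0 b (fun r => dotv (mxv A (c r).1) (v r)).
Proof.
move=> b1; apply: (integrable_on_sub (lexx 0) b1).
by apply: (integrable_dotv ler01 (vAC_mxv A horizontal_vAC)) => i; exact: hor.1.
Qed.

Lemma horizontal_t tau s : 0 <= s <= 1 ->
  dotv (c s).2 tau = 2^-1 * Rint 0 s (fun r => dotv (mxv (Ut U tau) (c r).1) (v r)).
Proof.
move=> s01; have /andP[s0 s1] := s01; have [_ ->] := hor.2 s s01.
rewrite c0 add0r dotvZl; congr (_ * _).
rewrite /dotv; under eq_bigr do rewrite mulrC mxE.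
have Ji j : integrable_on 0 s (fun r => Uform U (c r).1 (v r) 0 j).
  have := @integrable_Uform (U j) s s1; by congr integrable_on; apply/funext => r; rewrite mxE.
under eq_bigr => j _ do rewrite -(RintZ _ (Ji j)).
rewrite -Rint_sum; last by move=> j; exact: integrable_onZ.
apply: Rint_ext => r _; rewrite -[RHS]dotv_Uform; apply: eq_bigr => j _; by rewrite mulrC.
Qed.

Lemma horizontal_T_AC tau : AC 0 1 (fun s => 4 * dotv (c s).2 tau)
  (fun r => 2 * dotv (mxv (Ut U tau) (c r).1) (v r)).
Proof.
have I := integrable_Uform (Ut U tau) (lexx 1).
apply: AC_ext (ACZ 2 (AC_int 0 I)) => s s01.
by rewrite horizontal_t//; field.
Qed.

Lemma horizontal_length_ge tau g : c 1 = g -> Omega_star U tau -> phi U g tau <= length v ^+ 2.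
Proof.
move=> c1 Ot.
have S01 : ((0 : R) < 1) && ((1 : R) <= 1) by rewrite ltr01 lexx.
have x_0 : (c 0).1 = 0 by rewrite c0.
have T_0 : 4 * dotv (c 0).2 tau = 0 by rewrite c0 dot0v mulr0.
have Blt w := @Omega_star_eigen tau w Ot.
have := calibration_le (Ut_skew tau) Blt ler01 S01 horizontal_vAC x_0 T_0 (horizontal_T_AC tau).
rewrite mul1r c1; apply: le_trans; rewrite le_eqVlt; apply/orP; left; apply/eqP.
rewrite /phi; congr (dotv (mxv _ _) _ + _).
apply: (eq_mxfun (skew_sq_sym (Ut_skew tau))) => w we.
by rewrite hcotE//; exact: skew_sq_eigen_ge0 (Ut_skew tau) _ we.
Qed.

End Horizontal.

(** * The geodesic attached to a maximizer *)

Section Maximizer.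
Variables (x0 : 'rV[R]_q) (t0 theta : 'rV[R]_m).
Hypothesis maxtheta : is_global_max U (x0, t0) theta.
Local Notation B := (Ut U theta).
Let Bs : B^T = - B := Ut_skew theta.
Let Blt w (we : eigen (- (B *m B)) w) : w < pi ^+ 2 := Omega_star_eigen maxtheta.1 we.
Local Notation x := (traj B x0).
Local Notation zeta := (vel B x0).
Let xA : vAC 0 1 x zeta. Proof. exact: vAC_traj. Qed.

Lemma gamma0E s : gamma0 U x0 theta s =
  (x s, 2^-1 *: Rintv 0 s (fun r => Uform U (x r) (zeta r))).
Proof. by []. Qed.

Lemma horizontal_gamma0 : horizontal U (gamma0 U x0 theta) zeta.
Proof.
split; first by move=> i; exact: (xA i).1.
move=> s s01; split; last first.
  rewrite !gamma0E /=; set a := Rintv 0 0 _.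
  suff -> : a = 0 by rewrite scaler0 add0r.
  by apply/rowP => j; rewrite !mxE Rint_id.
by rewrite !gamma0E /=; apply/rowP => i; rewrite [RHS]mxE [X in _ = _ + X]mxE; exact: (xA i).2.
Qed.

Lemma gamma0_start : gamma0 U x0 theta 0 = origin R q m.
Proof.
rewrite gamma0E traj0//; congr pair.
by apply/rowP => j; rewrite !mxE Rint_id mulr0.
Qed.

Lemma gamma0_end : gamma0 U x0 theta 1 = (x0, t0).
Proof.
rewrite gamma0E traj1//; congr pair; apply/esym/eqP; rewrite -subr_eq0; apply/eqP.
set t1 := _ *: _; set u := t0 - t1.
have t1u : dotv t1 u = 2^-1 * Rint 0 1 (fun s => dotv (mxv (Ut U u) (x s)) (zeta s)).
  by rewrite -(horizontal_t horizontal_gamma0 gamma0_start) ?ler01 ?lexx.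
apply: dotv_eq0; apply/eqP; rewrite eq_le dotv_ge0 andbT.
have [lam [e0 [lam1 e00 O1 O2]]] := Omega_star_open_along u maxtheta.1.
have := @endpoint_inequality R q B (Ut U u) x0 (dotv t0 u) lam e0 Bs (Ut_skew u) lam1 e00 Blt.
have BE e : B + e *: Ut U u = Ut U (theta + e *: u) by rewrite UtD UtZ.
have P1 e : 0 < e < e0 -> forall w,
    eigen (- ((B + e *: Ut U u) *m (B + e *: Ut U u))) w -> w < pi ^+ 2.
  by move=> ee w; rewrite BE; exact: Omega_star_eigen (O1 e ee).
have P2 e : 0 < e < e0 -> forall w,
    eigen (- ((lam *: (B + e *: Ut U u)) *m (lam *: (B + e *: Ut U u)))) w -> w < pi ^+ 2.
  by move=> ee w; rewrite BE -UtZ; exact: Omega_star_eigen (O2 e ee).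
have P3 e : 0 < e < e0 ->
    dotv (vel (B + e *: Ut U u) x0 1) x0 + 4 * e * dotv t0 u <= dotv (zeta 1) x0.
  move=> ee; rewrite BE; have := maxtheta.2 _ (O1 e ee).
  rewrite !phi_vel; [|exact: maxtheta.1|exact: O1].
  by rewrite dotvDr dotvZr; lra.
move=> /(_ P1 P2 P3).
by rewrite {1}/u dotvDl dotvNl t1u; lra.
Qed.

Lemma joins_gamma0 : joins U (gamma0 U x0 theta) zeta (x0, t0).
Proof. by split; [exact: horizontal_gamma0|split; [exact: gamma0_start|exact: gamma0_end]]. Qed.

Lemma enorm_vel s : 0 <= s <= 1 -> enorm (zeta s) = enorm (zeta 0).
Proof. by move=> s01; rewrite /enorm (vel_sqnorm Bs Blt x0 s01). Qed.

Lemma length_gamma0 : length zeta = enorm (zeta 0).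
Proof.
rewrite /length (@Rint_ext _ _ _ _ (fun=> enorm (zeta 0))); last exact: enorm_vel.
by rewrite Rint_cst// subr0 mul1r.
Qed.

(** Along its own trajectory the calibration equals <zeta - B x, x> + 4 t.theta, a form regular at s
    = 0; its derivative is the constant |zeta|^2. *)
Lemma length_gamma0_sqr : length zeta ^+ 2 = phi U (x0, t0) theta.
Proof.
rewrite length_gamma0 enorm_sqr phi_vel; last exact: maxtheta.1.
have zA : vAC 0 1 zeta (fun s => 2 *: mxv B (zeta s)) by exact: vAC_vel.
have pA := AC_dotv ler01 (vACB zA (vAC_mxv B xA)) xA.
have TA := horizontal_T_AC horizontal_gamma0 gamma0_start theta.
have := AC_diff (ACD pA TA) (lexx 0) ler01 (lexx 1).
rewrite (@Rint_ext _ _ _ _ (fun=> dotv (zeta 0) (zeta 0))); last first.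
  move=> s s01; rewrite -(vel_sqnorm Bs Blt x0 s01) !(dotvDl, dotvNl, dotvZl) gamma0E /=.
  rewrite (skew_dotv (zeta s) _ Bs) (dotvC (zeta s) (mxv B (x s))); ring.
rewrite Rint_cst// subr0 mul1r => <-.
rewrite gamma0_end gamma0_start /= !traj1// !traj0// dotv0 dot0v mulr0 addr0 subr0.
by rewrite dotvDl dotvNl (skew_dotv0 _ Bs) subr0.
Qed.

Lemma dist_gamma0 : dist U (x0, t0) = length zeta.
Proof.
have ge_L c v : joins U c v (x0, t0) -> length zeta <= length v.
  move=> [hor [c0 c1]].
  have L0 (w : R -> 'rV[R]_q) : 0 <= length w.
    by apply: Rintegral_ge0 => r _; exact: enorm_ge0.
  rewrite -(@ler_pXn2r _ 2) ?nnegrE// length_gamma0_sqr.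
  by apply: (horizontal_length_ge hor c0 c1); exact: maxtheta.1.
apply/eqP; rewrite eq_le; apply/andP; split.
  apply: ge_inf; last by exists (gamma0 U x0 theta), zeta; split=> //; exact: joins_gamma0.
  by exists (length zeta) => _ [c [v [J ->]]]; exact: ge_L J.
apply: lb_le_inf.
  by exists (length zeta), (gamma0 U x0 theta), zeta; split=> //; exact: joins_gamma0.
by move=> _ [c [v [J ->]]]; exact: ge_L J.
Qed.

Lemma shortest_gamma0 : shortest_geodesic U (gamma0 U x0 theta) (x0, t0).
Proof. by exists zeta; split; [exact: joins_gamma0|rewrite dist_gamma0]. Qed.

Lemma length_gamma0_gt0 : (x0, t0) <> origin R q m -> 0 < length zeta.
Proof.
move=> g0; rewrite length_gamma0 lt_def enorm_ge0 andbT; apply/eqP => z0.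
apply: g0; rewrite -gamma0_end gamma0E.
have zs s : 0 <= s <= 1 -> zeta s = 0.
  by move=> s01; apply: dotv_eq0; rewrite -enorm_sqr enorm_vel// z0 expr0n.
have x1 : x 1 = 0.
  apply/rowP => i; have := (xA i).2 1; rewrite ler01 lexx => /(_ isT) ->.
  rewrite traj0// (@Rint_ext _ _ _ _ (fun=> 0)) ?Rint_cst// ?mulr0 ?addr0//.
  by move=> s /zs ->; rewrite mxE.
rewrite x1; congr pair; apply/rowP => j; rewrite !mxE (@Rint_ext _ _ _ _ (fun=> 0)) ?Rint_cst// ?mulr0//.
by move=> s /zs ->; rewrite mxE dotv0.
Qed.

(** * Uniqueness of the shortest geodesic *)

Section Uniqueness.
Variables (c : curve R q m) (v : R -> 'rV[R]_q).
Hypotheses (g_neq_o : (x0, t0) <> origin R q m).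
Hypotheses (cJ : joins U c v (x0, t0)) (vL : length v = dist U (x0, t0)).

Definition arclength s := (length v)^-1 * Rint 0 s (fun r => enorm (v r)).

Let hor := cJ.1.
Let c_0 : c 0 = origin R q m := cJ.2.1.
Let c_1 : c 1 = (x0, t0) := cJ.2.2.
Let cA := horizontal_vAC hor.
Let cTA := horizontal_T_AC hor c_0 theta.
Let x_0 : (c 0).1 = 0. Proof. by rewrite c_0. Qed.
Let x_1 : (c 1).1 = x0. Proof. by rewrite c_1. Qed.
Let T_0 : 4 * dotv (c 0).2 theta = 0. Proof. by rewrite c_0 dot0v mulr0. Qed.
Let ell0 : 0 < Rint 0 1 (fun r => enorm (v r)).
Proof. by rewrite -/(length v) vL dist_gamma0; exact: length_gamma0_gt0. Qed.
Let ell2 : dotv (mxv (mxfun (@hcot R) (- (B *m B))) x0) x0 + 4 * dotv (c 1).2 theta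
  = Rint 0 1 (fun r => enorm (v r)) ^+ 2.
Proof. by rewrite -/(length v) vL dist_gamma0 length_gamma0_sqr c_1. Qed.

Lemma shortest_eq_gamma0 s : 0 <= s <= 1 -> c s = gamma0 U x0 theta (arclength s).
Proof.
move=> s01; have /andP[s0 s1] := s01.
have [xs form] := minimizer_reparam Bs Blt cA x_0 x_1 T_0 cTA ell0 ell2 s01.
rewrite gamma0E [c s]surjective_pairing xs; congr pair.
apply/rowP => j.
have tE (c' : curve R q m) v' (r : R) : horizontal U c' v' -> c' 0 = origin R q m -> 0 <= r <= 1 ->
    (c' r).2 0 j = 2^-1 * Rint 0 r (fun r => dotv (mxv (U j) (c' r).1) (v' r)).
  move=> hor' c'0 r01; have [_ ->] := hor'.2 r r01; rewrite c'0 add0r !mxE; congr (_ * _).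
  by apply: Rint_ext => z _; rewrite mxE.
have I11 : ((0 : R) <= 1) && ((1 : R) <= 1) by rewrite ler01 lexx.
(* Both curves end at t0, which supplies the equality of totals required by [minimizer_reparam]. *)
have E1 : Rint 0 1 (fun r => dotv (mxv (U j) (c r).1) (v r)) =
    Rint 0 1 (fun s => dotv (mxv (U j) (x s)) (zeta s)).
  have H1 := tE _ _ 1 hor c_0 I11; have H2 := tE _ _ 1 horizontal_gamma0 gamma0_start I11.
  rewrite c_1 in H1; rewrite gamma0_end in H2.
  apply: (mulfI (x := 2^-1)); first by rewrite invr_neq0// pnatr_eq0.
  exact: etrans (esym H1) H2.
rewrite (tE _ _ s hor c_0 s01) (form _ E1) !mxE; congr (_ * _).
by apply: Rint_ext => r _; rewrite mxE.
Qed.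

Lemma arclength_reparam : [/\ arclength 0 = 0, arclength 1 = 1 &
  forall s1 s2, 0 <= s1 -> s1 <= s2 -> s2 <= 1 -> arclength s1 <= arclength s2].
Proof.
split; [exact: arclength0|exact: arclength1 ell0|].
exact: arclength_mono cA ell0.
Qed.

End Uniqueness.

Lemma ngeod_gamma0 s : 0 <= s <= 1 -> ngeod U (zeta 0) theta s = gamma0 U x0 theta s.
Proof.
move=> s01; have /andP[s0 s1] := s01.
have nE r : nzeta U (zeta 0) theta r = zeta r by rewrite /nzeta -vel_exp.
have xE r : 0 <= r <= 1 -> Rintv 0 r (nzeta U (zeta 0) theta) = x r.
  move=> r01; apply/rowP => i; rewrite mxE ((xA i).2 r r01) traj0// mxE add0r.
  by apply: Rint_ext => z _; rewrite nE.
rewrite /ngeod gamma0E (xE s s01); congr (_, _ *: _).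
apply/rowP => j; rewrite !mxE; apply: Rint_ext => r /andP[r0 rs].
by rewrite xE ?nE// r0 (le_trans rs s1).
Qed.

End Maximizer.

Lemma two_maximizers_abnormal x0 t0 theta tau : (x0, t0) <> origin R q m ->
  is_global_max U (x0, t0) theta -> is_global_max U (x0, t0) tau -> theta <> tau ->
  abnormal U (gamma0 U x0 theta).
Proof.
move=> g0 m1 m2 neq.
exists (vel (Ut U theta) x0 0), theta, (vel (Ut U tau) x0 0), tau; split.
  move=> s s01; rewrite (ngeod_gamma0 m1 s01) (ngeod_gamma0 m2 s01); split; first by [].
  have J := joins_gamma0 m2; have L := esym (dist_gamma0 m2).
  rewrite (shortest_eq_gamma0 m1 g0 J L s01); congr gamma0.
  have /andP[s0 s1] := s01.
  (* The geodesic of [tau] has constant speed, so its normalized arc length is the identity and the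
     two curves agree with the same parameter. *)
  rewrite /arclength (@Rint_ext _ _ _ _ (fun=> enorm (vel (Ut U tau) x0 0))); last first.
    by move=> r /andP[r0 rs]; apply: enorm_vel m2 _ _; rewrite r0 (le_trans rs s1).
  have := length_gamma0_gt0 m2 g0; rewrite Rint_cst// subr0 (length_gamma0 m2) => e0.
  by rewrite mulrC mulfK// lt0r_neq0.
exists 0; split; first by rewrite lexx ler01.
move=> E; apply: neq; apply: (scalerI (a := 2)); first by rewrite pnatr_eq0.
exact: (congr1 (fun p : point R q m * ('rV[R]_q * 'rV[R]_m) => p.2.2) E).
Qed.

End Subriemannian.

(** Length does not see the parametrization, so uniqueness means up to a nondecreasing change of
    parameter [rho], which the proof takes to be the normalized arc length. *)
Theorem theorem2p7 (R : realType) (q m : nat) (U : 'I_m -> 'M[R]_q)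
  (x0 : 'rV[R]_q) (t0 : 'rV[R]_m) (theta0 : 'rV[R]_m) :
  (0 < q)%N -> (0 < m)%N ->
  skew_family U -> lin_indep_family U ->
  Mtilde U (x0, t0) -> (x0, t0) <> origin R q m ->
  is_global_max U (x0, t0) theta0 ->
  [/\ dist U (x0, t0) ^+ 2 = phi U (x0, t0) theta0,
      shortest_geodesic U (gamma0 U x0 theta0) (x0, t0),
      (forall c : curve R q m, shortest_geodesic U c (x0, t0) ->
         exists rho : R -> R,
           [/\ rho 0 = 0, rho 1 = 1,
               (forall s1 s2, 0 <= s1 -> s1 <= s2 -> s2 <= 1 -> rho s1 <= rho s2)
             & forall s, 0 <= s <= 1 -> c s = gamma0 U x0 theta0 (rho s)])
    & Mtilde2 U (x0, t0) -> abnormal U (gamma0 U x0 theta0)].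
Proof.
move=> _ _ Uskew _ _ g0 maxth; split.
- by rewrite (dist_gamma0 Uskew maxth) (length_gamma0_sqr Uskew maxth).
- exact: shortest_gamma0.
- move=> c [v [J L]].
  have [rho0 rho1 rho_mono] := arclength_reparam Uskew maxth g0 J L.
  exists (arclength v); split; [exact: rho0|exact: rho1|exact: rho_mono|].
  by move=> s s01; exact: (shortest_eq_gamma0 Uskew maxth g0 J L s01).
- move=> [tau1 [tau2 [neq [max1 max2]]]].
  have [e1|n1] := eqVneq theta0 tau1.
    by apply: two_maximizers_abnormal max2 _ => //; rewrite e1.
  by apply: two_maximizers_abnormal max1 _ => //; exact/eqP.
Qed.
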